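(* On the manifold $\mathcal{N}$ the Poincaré--Cartan form $$\theta = e\,\beta\wedge\gamma+p^{ab}_i\,d\eta^i_a\wedge\beta_b\wedge\gamma+(-1)^n p^{aj}_i\,d\eta^i_a\wedge\beta\wedge\gamma_j$$ reads $$\theta=\epsilon\,\beta\wedge\gamma+p_i\wedge(d\eta+\eta\wedge\eta)^i,$$ where $$p_i:=-\tfrac12\,p^{ab}_i\,\beta_{ab}\wedge\gamma+(-1)^n p^{aj}_i\,\beta_a\wedge\gamma_j ,$$ $\eta=\eta_a\beta^a+t_i\gamma^i$ with $\eta_a=t_i\eta^i_a$ is the canonical $\mathfrak g$-valued 1-form, and $$\epsilon:=e-\tfrac12 p^{ab}_i\eta^i_c(\Gamma^c_{ab}-\Gamma^c_{ba})+\tfrac12 p^{ab}_i[\eta_a,\eta_b]^i+p^{aj}_i[\eta_a,t_j]^i .$$ (Summation over all repeated indices.)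
   Context: Setting. $\mathcal{M}$ is an $n$-dimensional manifold with a pseudo-Riemannian metric $\textsf{g}$; $\mathfrak{G}$ is a Lie group of matrices of dimension $r$ with Lie algebra $\mathfrak{g}$ and basis $(t_1,\dots,t_r)$ of $\mathfrak g$; for $\xi\in\mathfrak g$, $\xi^i$ denotes its $i$-th component in this basis, and likewise for $\mathfrak g$-valued forms. $\pi_{\mathcal M}:\mathcal{P}\to\mathcal{M}$ is a principal bundle with structure group $\mathfrak{G}$ acting on the right by $R_g(z)=z\cdot g$. Frames. $\rho_j(z)=\frac{d}{dt}(z\cdot e^{t t_j})|_{t=0}$. One chooses a (local) orthonormal frame $(\underline e_1,\dots,\underline e_n)$ of $T\mathcal{M}$ (its scalar products are constant) and a (local) section $\boldsymbol\sigma$ of $\mathcal P$, identifying $z=\boldsymbol\sigma(x)\cdot g$ with $(x,g)$, and sets $e_a(z)=d(R_g\circ\boldsymbol\sigma)_x(\underline e_a(x))$. $(\beta^1,\dots,\beta^n,\gamma^1,\dots,\gamma^r)$ is the coframe on $\mathcal P$ dual to $(e_1,\dots,e_n,\rho_1,\dots,\rho_r)$; in particular $t_i\gamma^i=g^{-1}dg$. Put $\beta=\beta^1\wedge\cdots\wedge\beta^n$, $\gamma=\gamma^1\wedge\cdots\wedge\gamma^r$, and, with $\iota$ the interior product, $\beta_a=\iota_{e_a}\beta$, $\beta_{ab}=\iota_{e_b}\iota_{e_a}\beta$, $\gamma_j=\iota_{\rho_j}\gamma$. $\omega^b_a$ are the connection 1-forms of the Levi-Civita connection $\underline\nabla$ of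 $\textsf{g}$, $\underline\nabla_{\underline e_a}\underline e_b=\omega^c_b(\underline e_a)\underline e_c$, pulled back to $\mathcal P$, and $\Gamma^c_{ab}:=\omega^c_b(e_a)$, so $\omega^c_b=\Gamma^c_{ab}\beta^a$. The manifold $\mathcal N$. Let $\mathfrak g\otimes^{\textsc{n}}T^*\mathcal P=\{(z,\eta)\in\mathfrak g\otimes T^*\mathcal P:\ \eta(z\cdot\xi)=\xi\ \forall\xi\in\mathfrak g\}$ (where $z\cdot\xi=\frac{d}{dt}(z\cdot e^{t\xi})|_{t=0}$), with coordinates $(x,g,\eta^i_a)$ given by $z=\boldsymbol\sigma(x)\cdot g$, $\eta=t_i(\eta^i_a\beta^a+\gamma^i)$. Let $\Lambda^{n+r}_1T^*(\mathfrak g\otimes^{\textsc n}T^*\mathcal P)$ be the bundle over $\mathfrak g\otimes^{\textsc n}T^*\mathcal P$ of those $(n+r)$-forms $\varpi$ that vanish upon contraction with any two vectors tangent to the fibres of $\mathfrak g\otimes^{\textsc n}T^*\mathcal P\to\mathcal P$; fibre coordinates $(e,p^{ab}_i,p^{aj}_i)$ are the components of $\varpi$ in the basis $(\beta\wedge\gamma,\ d\eta^i_a\wedge\beta_b\wedge\gamma,\ (-1)^nd\eta^i_a\wedge\beta\wedge\gamma_j)$. The Poincaré--Cartan form $\theta$ is the restriction to $\mathcal N$ of the canonical (tautological) $(n+r)$-form on this bundle, which in these coordinates has the first expression displayed in the claim. Finally $$\mathcal N:=\{(z,\eta,\varpi)\in\Lambda^{n+r}_1T^*(\mathfrak g\otimes^{\textsc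 n}T^*\mathcal P):\ p^{ab}_i+p^{ba}_i=0\}.$$ All forms on $\mathcal P$ are regarded as forms on $\mathcal N$ by pull-back. $\eta\wedge\eta$ is the wedge product using matrix multiplication, i.e. $\eta\wedge\eta=\frac12[\eta\wedge\eta]$. *)

(* Defs.v *)
(* Conventions.
   - A manifold carries a preferred chart [chart_at p] around each point p, and
     the tangent space at p is 'rV[R]_d, read in the preferred chart of p.
   - Indices run over 'I_n and 'I_r, hence start at 0.
   - A (possibly inhomogeneous) form on a vector space V with values in a ring A
     is a function seq V -> A; its k-form part is its restriction to lists of
     length k. This avoids casts between degrees such as (n - 2) + r + 2 and
     n + r. *)
From HB Require Import structures.
From mathcomp Require Import all_boot all_order all_algebra.
From mathcomp Require Import all_classical all_reals all_analysis.
Set Implicit Arguments.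
Unset Strict Implicit.
Unset Printing Implicit Defensive.
Import Order.TTheory GRing.Theory Num.Theory numFieldNormedType.Exports.
Local Open Scope classical_set_scope.
Local Open Scope ring_scope.

Definition form (A V : Type) := seq V -> A.

Definition one_form (A : pzRingType) (V : Type) (alpha : V -> A) : form A V :=
  fun s => if s is [:: v] then alpha v else 0.

Definition two_form (A : pzRingType) (V : Type) (alpha : V -> V -> A) :
  form A V := fun s => if s is [:: u; v] then alpha u v else 0.

Definition form1 (A : pzRingType) (V : Type) : form A V :=
  fun s => if s is [::] then 1 else 0.

Definition interior (A V : Type) (v : V) (w : form A V) : form A V :=
  fun s => w (v :: s).

Definition pullback (A V W : Type) (f : V -> W) (w : form A W) : form A V :=
  fun s => w (map f s).

(* The shuffle product (no factorials; (a /\ b)(u, v) = a u * b v - a v * b u on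
   1-forms), computed from
   i_v (a /\ b) = i_v a /\ b + (-1)^(deg a) a /\ i_v b. *)
Fixpoint wedge (A : pzRingType) (V : Type) (a b : form A V) (s : seq V) : A :=
  if s is v :: s' then
    wedge (interior v a) b s' +
    wedge (fun u => (-1) ^+ size u * a u) (interior v b) s'
  else a [::] * b [::].

Record alternating_form (R : realType) (V : lmodType R) (k : nat)
    (w : form R V) : Prop := AlternatingForm {
  alt_degree : forall s, size s <> k -> w s = 0;
  alt_linear : forall s1 s2 (c : R) u v,
    w (s1 ++ (c *: u + v) :: s2) = c * w (s1 ++ u :: s2) + w (s1 ++ v :: s2);
  alt_repeat : forall s1 s2 s3 u, w (s1 ++ u :: s2 ++ u :: s3) = 0 }.

Section Smooth.
Variables (R : realType) (V W : normedModType R).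

Definition iter_derive (s : seq V) (f : V -> W) : V -> W :=
  foldr (fun v h => (fun x => 'D_v h x)) f s.

(* C^oo on a neighbourhood of x (for V finite dimensional) *)
Definition smooth_near (f : V -> W) (x : V) : Prop :=
  \forall y \near x, forall s, differentiable (iter_derive s f) y.

End Smooth.

Record chart (R : realType) (d : nat) (T : topologicalType) := Chart {
  chart_dom : set T;
  chart_coord : T -> 'rV[R]_d;
  chart_inv : 'rV[R]_d -> T;
  chart_dom_open : open chart_dom;
  chart_img_open : open (chart_coord @` chart_dom);
  chart_invK : forall p, chart_dom p -> chart_inv (chart_coord p) = p;
  chart_coord_cts :
    forall p, chart_dom p -> {for p, continuous chart_coord};
  chart_inv_cts :
    forall p, chart_dom p -> {for chart_coord p, continuous chart_inv} }.

Record manifold (R : realType) (d : nat) := Manifold {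
  mfd_carrier :> topologicalType;
  mfd_hausdorff : hausdorff_space mfd_carrier;
  mfd_second_countable : @second_countable mfd_carrier;
  chart_at : mfd_carrier -> chart R d mfd_carrier;
  chart_at_dom : forall p, chart_dom (chart_at p) p;
  chart_at_smooth : forall p q x,
    chart_dom (chart_at p) x -> chart_dom (chart_at q) x ->
    smooth_near (chart_coord (chart_at q) \o chart_inv (chart_at p))
      (chart_coord (chart_at p) x) }.

Section Calculus.
Variables (R : realType) (d : nat) (M : manifold R d).

Definition coord_at (p : M) : M -> 'rV[R]_d := chart_coord (chart_at p).
Definition inv_at (p : M) : 'rV[R]_d -> M := chart_inv (chart_at p).
Definition center (p : M) : 'rV[R]_d := coord_at p p.

(* the vector v at the point of coordinates x in the chart of p, rewritten in
   the chart of q *)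
Definition change_chart (p q : M) (x v : 'rV[R]_d) : 'rV[R]_d :=
  'D_v (coord_at q \o inv_at p) x.

Definition smooth_fun_at (W : normedModType R) (f : M -> W) (p : M) : Prop :=
  smooth_near (f \o inv_at p) (center p).

Definition dfun (W : normedModType R) (f : M -> W) (p : M) (v : 'rV[R]_d) : W :=
  'D_v (f \o inv_at p) (center p).

Definition vfield := M -> 'rV[R]_d.

Definition vfield_in_chart (X : vfield) (p : M) (x : 'rV[R]_d) : 'rV[R]_d :=
  let q := inv_at p x in change_chart q p (center q) (X q).

Definition smooth_vfield_at (X : vfield) (p : M) : Prop :=
  smooth_near (vfield_in_chart X p) (center p).

Definition lie_bracket (X Y : vfield) : vfield := fun p =>
  'D_(X p) (vfield_in_chart Y p) (center p) -
  'D_(Y p) (vfield_in_chart X p) (center p).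

(* exterior derivative of a W-valued 1-form:
   d alpha (u, v) = d_u (alpha v) - d_v (alpha u) for u, v constant in the chart
   of p *)
Definition dform (W : normedModType R) (alpha : M -> 'rV[R]_d -> W)
    (p : M) (u v : 'rV[R]_d) : W :=
  let local w x := let q := inv_at p x in alpha q (change_chart p q x w) in
  'D_u (local v) (center p) - 'D_v (local u) (center p).

End Calculus.

Section Maps.
Variables (R : realType) (d1 d2 d3 : nat).
Variables (M1 : manifold R d1) (M2 : manifold R d2) (M3 : manifold R d3).

Definition smooth_map_at (f : M1 -> M2) (p : M1) : Prop :=
  {for p, continuous f} /\
  smooth_near (coord_at (f p) \o f \o inv_at p) (center p).

(* smoothness on M1 x M2, in the product of the preferred charts *)
Definition smooth_map2_at (f : M1 -> M2 -> M3) (p : M1) (q : M2) : Prop :=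
  {for (p, q), continuous (fun pq => f pq.1 pq.2)} /\
  smooth_near (fun w : 'rV[R]_(d1 + d2) =>
      coord_at (f p q) (f (inv_at p (lsubmx w)) (inv_at q (rsubmx w))))
    (row_mx (center p) (center q)).

Definition tangent_map (f : M1 -> M2) (p : M1) (v : 'rV[R]_d1) : 'rV[R]_d2 :=
  'D_v (coord_at (f p) \o f \o inv_at p) (center p).

Definition smooth_curve_at (c : R -> M1) (s : R) : Prop :=
  {for s, continuous c} /\ smooth_near (coord_at (c s) \o c) s.

Definition velocity (c : R -> M1) (s : R) : 'rV[R]_d1 :=
  'D_1 (coord_at (c s) \o c) s.

End Maps.

Record metric (R : realType) (n : nat) (M : manifold R n) := Metric {
  gram : M -> 'M[R]_n;
  gram_sym : forall p, (gram p)^T = gram p;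
  gram_nondeg : forall p, gram p \in unitmx;
  gram_smooth : forall p u v, smooth_near (fun x => let q := inv_at p x in
      (change_chart p q x u *m gram q *m (change_chart p q x v)^T) 0 0)
    (center p) }.

Definition inner (R : realType) (n : nat) (M : manifold R n) (g : metric M)
    (p : M) (u v : 'rV[R]_n) : R := (u *m gram g p *m v^T) 0 0.

(* [nabla Y p v] is the covariant derivative of Y at p along v; only its values
   on fields Y that are smooth around p are constrained. *)
Record levi_civita (R : realType) (n : nat) (M : manifold R n) (g : metric M)
    (nabla : vfield M -> M -> 'rV[R]_n -> 'rV[R]_n) : Prop := LeviCivita {
  lc_linear : forall Y p, linear (nabla Y p);
  lc_add : forall Y Z p v, smooth_vfield_at Y p -> smooth_vfield_at Z p ->
    nabla (fun q => Y q + Z q) p v = nabla Y p v + nabla Z p v;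
  lc_leibniz : forall (f : M -> R) Y p v,
    smooth_fun_at f p -> smooth_vfield_at Y p ->
    nabla (fun q => f q *: Y q) p v = dfun f p v *: Y p + f p *: nabla Y p v;
  lc_smooth : forall X Y p, smooth_vfield_at X p -> smooth_vfield_at Y p ->
    smooth_vfield_at (fun q => nabla Y q (X q)) p;
  lc_torsion_free : forall X Y p,
    smooth_vfield_at X p -> smooth_vfield_at Y p ->
    nabla Y p (X p) - nabla X p (Y p) = lie_bracket X Y p;
  lc_metric : forall Y Z p v, smooth_vfield_at Y p -> smooth_vfield_at Z p ->
    dfun (fun q => inner g q (Y q) (Z q)) p v =
      inner g p (nabla Y p v) (Z p) + inner g p (Y p) (nabla Z p v) }.

(* The group may be any Lie group with an injective smooth representation; mat is
   not required to be a closed embedding. *)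
Record matrix_lie_group (R : realType) (r m : nat) := MatrixLieGroup {
  mlg_mfd :> manifold R r;
  mat : mlg_mfd -> 'M[R]_m;
  mlg1 : mlg_mfd;
  mlgM : mlg_mfd -> mlg_mfd -> mlg_mfd;
  mlgV : mlg_mfd -> mlg_mfd;
  mat_inj : injective mat;
  mat1 : mat mlg1 = 1%:M;
  matM : forall h k, mat (mlgM h k) = mat h *m mat k;
  matV : forall h, mat (mlgV h) *m mat h = 1%:M;
  mat_smooth : forall h, smooth_fun_at mat h;
  mlgM_smooth : forall h k, smooth_map2_at mlgM h k;
  mlgV_smooth : forall h, smooth_map_at mlgV h }.

Definition mexp (R : realType) (m : nat) (X : 'M[R]_m) : 'M[R]_m :=
  lim (series (fun k => (k`!%:R)^-1 *: X ^+ k) @ \oo).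

Section LieAlgebra.
Variables (R : realType) (r m : nat) (G : matrix_lie_group R r m).

(* xi generates a smooth one-parameter subgroup s |-> e^{s xi} of G *)
Definition in_lie_algebra (xi : 'M[R]_m) : Prop :=
  exists c : R -> G, forall s : R,
    smooth_curve_at c s /\ mat (c s) = mexp (s *: xi).

Definition lie_exp (xi : 'M[R]_m) : G :=
  xget (mlg1 G) [set h | mat h = mexp xi].

Record lie_basis := LieBasis {
  lb_tuple :> r.-tuple 'M[R]_m;
  lb_free : free lb_tuple;
  lb_span : forall xi, in_lie_algebra xi <-> xi \in <<lb_tuple>>%VS }.

End LieAlgebra.

Definition commutator (R : realType) (m : nat) (X Y : 'M[R]_m) : 'M[R]_m :=
  X *m Y - Y *m X.

Record principal_bundle (R : realType) (n r m : nat) (M : manifold R n)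
    (G : matrix_lie_group R r m) (P : manifold R (n + r)) := PrincipalBundle {
  proj : P -> M;
  act : P -> G -> P;
  proj_smooth : forall z, smooth_map_at proj z;
  act_smooth : forall z h, smooth_map2_at act z h;
  act1 : forall z, act z (mlg1 G) = z;
  actM : forall z h k, act z (mlgM h k) = act (act z h) k;
  proj_act : forall z h, proj (act z h) = proj z;
  (* around every point, an equivariant diffeomorphism
     z |-> (proj z, tau z) onto U x G, of inverse psi *)
  local_triviality : forall x, exists U : set M, exists tau : P -> G,
    exists psi : M -> G -> P,
    [/\ open U, U x,
        forall z, U (proj z) -> smooth_map_at tau z,
        forall y h, U y -> smooth_map2_at psi y h &
        [/\ forall z h, U (proj z) -> tau (act z h) = mlgM (tau z) h,
            forall y h, U y -> proj (psi y h) = y,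
            forall y h, U y -> tau (psi y h) = h &
            forall z, U (proj z) -> psi (proj z) (tau z) = z]] }.

Section Fundamental.
Variables (R : realType) (n r m : nat) (M : manifold R n).
Variables (G : matrix_lie_group R r m) (P : manifold R (n + r)).
Variable B : principal_bundle M G P.

(* z . xi = d/ds (z . e^{s xi}) at s = 0 *)
Definition fundamental (xi : 'M[R]_m) (z : P) : 'rV[R]_(n + r) :=
  velocity (fun s : R => act B z (lie_exp G (s *: xi))) 0.

End Fundamental.

Record local_frame (R : realType) (n r m : nat) (M : manifold R n)
    (g : metric M) (G : matrix_lie_group R r m) (P : manifold R (n + r))
    (B : principal_bundle M G P) := LocalFrame {
  lf_dom : set M;
  lf_e : 'I_n -> vfield M;
  lf_sign : 'I_n -> bool;
  lf_sigma : M -> P;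
  lf_dom_open : open lf_dom;
  lf_e_smooth : forall a x, lf_dom x -> smooth_vfield_at (lf_e a) x;
  lf_orthonormal : forall a b x, lf_dom x ->
    inner g x (lf_e a x) (lf_e b x) = if a == b then (-1) ^+ lf_sign a else 0;
  lf_sigma_smooth : forall x, lf_dom x -> smooth_map_at lf_sigma x;
  lf_sigma_section : forall x, lf_dom x -> proj B (lf_sigma x) = x }.

Section Frame.
Variables (R : realType) (n r m : nat) (M : manifold R n) (g : metric M).
Variables (G : matrix_lie_group R r m) (t : lie_basis G).
Variables (P : manifold R (n + r)) (B : principal_bundle M G P).
Variable F : local_frame g B.

(* the h such that z = sigma(x) . h *)
Definition gauge (z : P) : G :=
  xget (mlg1 G) [set h | act B (lf_sigma F (proj B z)) h = z].

Definition frame_e (a : 'I_n) (z : P) : 'rV[R]_(n + r) :=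
  tangent_map (fun x => act B (lf_sigma F x) (gauge z)) (proj B z)
    (lf_e F a (proj B z)).

Definition frame_rho (j : 'I_r) (z : P) : 'rV[R]_(n + r) :=
  fundamental B (tnth t j) z.

Definition frame_mx (z : P) : 'M[R]_(n + r) :=
  col_mx (\matrix_a frame_e a z) (\matrix_j frame_rho j z).

(* the dual coframe: the coordinates of v in the basis (e_a, rho_j) *)
Definition coframe_beta (a : 'I_n) (z : P) (v : 'rV[R]_(n + r)) : R :=
  (v *m invmx (frame_mx z)) 0 (lshift r a).
Definition coframe_gamma (j : 'I_r) (z : P) (v : 'rV[R]_(n + r)) : R :=
  (v *m invmx (frame_mx z)) 0 (rshift n j).

Definition vol_beta (z : P) : form R 'rV[R]_(n + r) :=
  \big[@wedge R _ / @form1 R _]_(a < n) one_form (coframe_beta a z).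
Definition vol_gamma (z : P) : form R 'rV[R]_(n + r) :=
  \big[@wedge R _ / @form1 R _]_(j < r) one_form (coframe_gamma j z).

Definition beta1 (a : 'I_n) (z : P) : form R 'rV[R]_(n + r) :=
  interior (frame_e a z) (vol_beta z).
Definition beta2 (a b : 'I_n) (z : P) : form R 'rV[R]_(n + r) :=
  interior (frame_e b z) (interior (frame_e a z) (vol_beta z)).
Definition gamma1 (j : 'I_r) (z : P) : form R 'rV[R]_(n + r) :=
  interior (frame_rho j z) (vol_gamma z).

(* omega c b is the connection 1-form omega^c_b on M *)
Definition connection_forms (nabla : vfield M -> M -> 'rV[R]_n -> 'rV[R]_n)
    (omega : 'I_n -> 'I_n -> M -> 'rV[R]_n -> R) : Prop :=
  forall b x v, lf_dom F x ->
    nabla (lf_e F b) x v = \sum_c omega c b x v *: lf_e F c x.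

(* Gamma^c_ab = (pull-back of omega^c_b to P)(e_a) *)
Definition christoffel (omega : 'I_n -> 'I_n -> M -> 'rV[R]_n -> R)
    (c a b : 'I_n) (z : P) : R :=
  omega c b (proj B z) (tangent_map (proj B) z (frame_e a z)).

End Frame.

Section NormalizedForms.
Variables (R : realType) (n r m : nat) (M : manifold R n) (g : metric M).
Variables (G : matrix_lie_group R r m) (t : lie_basis G).
Variables (P : manifold R (n + r)) (B : principal_bundle M G P).
Variable F : local_frame g B.

Definition normalized_form (z : P) (eta : 'rV[R]_(n + r) -> 'M[R]_m) : Prop :=
  [/\ linear eta, forall v, in_lie_algebra G (eta v) &
      forall xi, in_lie_algebra G xi -> eta (fundamental B xi z) = xi].

(* Total space of the bundle of pairs (z, eta): its points are such pairs, and
   over the domain of the frame its smooth structure is the one for which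
   (z, eta^i_a) are coordinates (a smooth bijection with injective differential
   between manifolds of equal dimension is a diffeomorphism). *)
Record normalized_bundle := NormalizedBundle {
  nb_mfd :> manifold R (n + r + r * n);
  nb_proj : nb_mfd -> P;
  nb_eta : nb_mfd -> 'rV[R]_(n + r) -> 'M[R]_m;
  nb_coef (i : 'I_r) (a : 'I_n) (y : nb_mfd) : R :=
    coord t i (nb_eta y (frame_e F a (nb_proj y)));
  nb_normalized : forall y, normalized_form (nb_proj y) (nb_eta y);
  nb_points : forall z eta, normalized_form z eta ->
    exists! y, nb_proj y = z /\ nb_eta y = eta;
  nb_proj_smooth : forall y, smooth_map_at nb_proj y;
  nb_coef_smooth : forall i a y, lf_dom F (proj B (nb_proj y)) ->
    smooth_fun_at (nb_coef i a) y;
  nb_coordinates : forall y v, lf_dom F (proj B (nb_proj y)) ->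
    tangent_map nb_proj y v = 0 -> (forall i a, dfun (nb_coef i a) y v = 0) ->
    v = 0 }.

(* e beta/\gamma + p^ab_i deta^i_a /\ beta_b /\ gamma
     + (-1)^n p^aj_i deta^i_a /\ beta /\ gamma_j
   on a space V over T_z P (via f); p i a b is p^ab_i and q i a j is p^aj_i. *)
Definition pc_expression (V : Type) (z : P) (f : V -> 'rV[R]_(n + r))
    (deta : 'I_r -> 'I_n -> V -> R) (e : R) (p : 'I_r -> 'I_n -> 'I_n -> R)
    (q : 'I_r -> 'I_n -> 'I_r -> R) : form R V := fun s =>
  let up := pullback f in
  let beta := vol_beta t F z in let gamma := vol_gamma t F z in
  e * wedge (up beta) (up gamma) s
  + \sum_i \sum_a \sum_b p i a b *
      wedge (one_form (deta i a))
        (wedge (up (beta1 t F b z)) (up gamma)) s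
  + (-1) ^+ n * \sum_i \sum_a \sum_j q i a j *
      wedge (one_form (deta i a))
        (wedge (up beta) (up (gamma1 t F j z))) s.

Variable E : normalized_bundle.

Definition pc_basis_expansion (y : E) :=
  pc_expression (nb_proj y) (tangent_map (@nb_proj E) y)
    (fun i a => dfun (@nb_coef E i a) y).

(* w belongs to the fibre of N over y: an (n+r)-form that vanishes upon
   contraction with two vertical vectors and whose components satisfy
   p^ab_i + p^ba_i = 0 *)
Definition in_N_fibre (y : E) (w : form R 'rV[R]_(n + r + r * n)) : Prop :=
  [/\ alternating_form (n + r) w,
      forall u v s, tangent_map (@nb_proj E) y u = 0 ->
        tangent_map (@nb_proj E) y v = 0 -> w (u :: v :: s) = 0 &
      forall e p q, w = pc_basis_expansion y e p q ->
        forall i a b, p i a b + p i b a = 0].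

(* The part of N over the domain of the frame, with its points (y, w), its fibre
   coordinates (e, p, q) and the smooth structure for which they are, together
   with the coordinates of y, coordinates on N. *)
Record multimomentum_manifold := MultimomentumManifold {
  mm_mfd :> manifold R (n + r + r * n + (1 + r * 'C(n, 2) + r * n * r));
  mm_proj : mm_mfd -> E;
  mm_form : mm_mfd -> form R 'rV[R]_(n + r + r * n);
  mm_e : mm_mfd -> R;
  mm_p : 'I_r -> 'I_n -> 'I_n -> mm_mfd -> R;
  mm_q : 'I_r -> 'I_n -> 'I_r -> mm_mfd -> R;
  mm_dom : forall nu, lf_dom F (proj B (nb_proj (mm_proj nu)));
  mm_fibre : forall nu, in_N_fibre (mm_proj nu) (mm_form nu);
  mm_components : forall nu, mm_form nu =
    pc_basis_expansion (mm_proj nu) (mm_e nu)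
      (fun i a b => mm_p i a b nu) (fun i a j => mm_q i a j nu);
  mm_points : forall y w, lf_dom F (proj B (nb_proj y)) -> in_N_fibre y w ->
    exists! nu, mm_proj nu = y /\ mm_form nu = w;
  mm_proj_smooth : forall nu, smooth_map_at mm_proj nu;
  mm_e_smooth : forall nu, smooth_fun_at mm_e nu;
  mm_p_smooth : forall i a b nu, smooth_fun_at (mm_p i a b) nu;
  mm_q_smooth : forall i a j nu, smooth_fun_at (mm_q i a j) nu;
  mm_coordinates : forall nu v,
    tangent_map mm_proj nu v = 0 -> dfun mm_e nu v = 0 ->
    (forall i a b, dfun (mm_p i a b) nu v = 0) ->
    (forall i a j, dfun (mm_q i a j) nu v = 0) -> v = 0 }.

End NormalizedForms.

Section FormsOnN.
Variables (R : realType) (n r m : nat) (M : manifold R n) (g : metric M).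
Variables (G : matrix_lie_group R r m) (t : lie_basis G).
Variables (P : manifold R (n + r)) (B : principal_bundle M G P).
Variables (F : local_frame g B) (E : normalized_bundle t F).
Variable N : multimomentum_manifold E.
Variable omega : 'I_n -> 'I_n -> M -> 'rV[R]_n -> R.

Local Notation dimN := (n + r + r * n + (1 + r * 'C(n, 2) + r * n * r))%N.

Definition N_proj (nu : N) : P := nb_proj (mm_proj nu).

Definition from_P (w : P -> form R 'rV[R]_(n + r)) (nu : N) :
    form R 'rV[R]_dimN :=
  pullback (tangent_map N_proj nu) (w (N_proj nu)).

(* the tautological form: at (y, w), the pull-back of w by N -> E *)
Definition poincare_cartan (nu : N) : form R 'rV[R]_dimN :=
  pullback (tangent_map (fun x : N => mm_proj x) nu) (mm_form nu).

Definition canonical_eta (nu : N) (v : 'rV[R]_dimN) : 'M[R]_m :=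
  nb_eta (mm_proj nu) (tangent_map N_proj nu v).

Definition eta_coef (i : 'I_r) (a : 'I_n) (nu : N) : R :=
  nb_coef i a (mm_proj nu).

(* eta_a = t_i eta^i_a *)
Definition eta_mx (a : 'I_n) (nu : N) : 'M[R]_m :=
  \sum_i eta_coef i a nu *: tnth t i.

(* (d eta + eta /\ eta)^i *)
Definition curvature (i : 'I_r) (nu : N) : form R 'rV[R]_dimN := fun s =>
  coord t i (two_form (dform canonical_eta nu) s +
    wedge (one_form (canonical_eta nu)) (one_form (canonical_eta nu)) s).

Definition momentum_form (i : 'I_r) (nu : N) : form R 'rV[R]_dimN := fun s =>
  - (2^-1 * \sum_a \sum_b mm_p i a b nu *
      wedge (from_P (beta2 t F a b) nu) (from_P (vol_gamma t F) nu) s)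
  + (-1) ^+ n * \sum_a \sum_j mm_q i a j nu *
      wedge (from_P (beta1 t F a) nu) (from_P (gamma1 t F j) nu) s.

Definition epsilon (nu : N) : R :=
  mm_e nu
  - 2^-1 * (\sum_i \sum_a \sum_b \sum_c mm_p i a b nu * eta_coef i c nu *
      (christoffel F omega c a b (N_proj nu) -
       christoffel F omega c b a (N_proj nu)))
  + 2^-1 * (\sum_i \sum_a \sum_b mm_p i a b nu *
      coord t i (commutator (eta_mx a nu) (eta_mx b nu)))
  + \sum_i \sum_a \sum_j mm_q i a j nu *
      coord t i (commutator (eta_mx a nu) (tnth t j)).

End FormsOnN.

(* Main.v *)
Require Import Defs.
From HB Require Import structures.
From mathcomp Require Import all_boot all_order all_algebra.
From mathcomp Require Import perm ring lra.
From mathcomp Require Import all_classical all_reals all_analysis.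
Set Implicit Arguments.
Unset Strict Implicit.
Unset Printing Implicit Defensive.
Import Order.TTheory GRing.Theory Num.Theory numFieldNormedType.Exports.
Import Defs.
Local Open Scope classical_set_scope.
Local Open Scope ring_scope.

(* At a point the claim is an identity in exterior algebra. Write the curvature as
     (d eta + eta /\ eta)^i = d eta^i_a /\ beta^a + 1/2 F^i_ab beta^a /\ beta^b
        + [eta_a, t_j]^i beta^a /\ gamma^j,
     F^i_ab = [eta_a, eta_b]^i - eta^i_c (Gamma^c_ab - Gamma^c_ba),
   and multiply by p_i, using beta^c /\ beta_ab = delta^c_b beta_a - delta^c_a beta_b
   and p^ab_i = - p^ba_i.
   For the curvature, eta = eta_a beta^a + A^-1 dA, where A is the matrix of the h
   such that z = sigma(x) . h. The form A^-1 dA kills e_a and sends rho_j to t_j, so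
   it is t_j gamma^j, and d (A^-1 dA) = - A^-1 dA /\ A^-1 dA cancels the
   gamma /\ gamma part of eta /\ eta. Since the connection is torsion free,
   d beta^a (e_b, e_c) = - beta^a [e_b, e_c] = - (Gamma^a_bc - Gamma^a_cb). *)

(** * The exterior algebra *)

(** The obstacle is [dform]: it evaluates a form at each nearby point in that point's own preferred
    chart. Before eta can be differentiated at nu, it has to be rewritten, on a whole neighbourhood,
    through functions on the single chart of nu. Since beta^a is pulled back from M, it becomes the
    derivative of the base coordinates times the inverse of the frame matrix; the other part is A^-1
    times the derivative of A. Differentiating these expressions produces second derivatives of the
    base coordinates and of A, which drop out of d eta by symmetry. So everything must be C^2 near
    nu, including the group element h, which is only picked by choice; a local trivialization gives
    a formula for it. In the algebra, the factor -1/2 in p_i compensates the two equal contributions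
    of beta^c /\ beta_ab, and its sign (-1)^n compensates moving gamma^j past the n factors of beta.
    The products of p_i with the last two parts of the curvature are multiples of beta /\ gamma, and
    epsilon - e is minus their total coefficient. *)

(* Forms with the wedge product as multiplication. The ring axioms hold for
   arbitrary functions on lists, alternating or not. *)
Definition ext (R : pzRingType) (V : Type) := form R V.

HB.instance Definition _ (R : pzRingType) (V : Type) :=
  GRing.Zmodule.copy (ext R V) (seq V -> R).

(** The grading involution, the sign (-1)^k in degree k. With it, contraction obeys an
    antiderivation rule on inhomogeneous forms too. *)
Definition grade_inv (R : pzRingType) (V : Type) (a : ext R V) : ext R V :=
  fun s => (-1) ^+ size s * a s.

Section WedgeRing.
Variables (R : pzRingType) (V : Type).
Implicit Types a b c : ext R V.

Lemma interiorD v a b : interior v (a + b) = interior v a + interior v b :> ext R V.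
Proof. by []. Qed.

Lemma grade_invD a b : grade_inv (a + b) = grade_inv a + grade_inv b.
Proof. by apply/funext => s; rewrite /grade_inv /= [(a + b) s]/(a s + b s) mulrDr. Qed.

Lemma grade_invK : involutive (@grade_inv R V).
Proof. by move=> a; apply/funext => s; rewrite /grade_inv mulrA -expr2 sqrr_sign mul1r. Qed.

Lemma grade_inv_interior v a :
  interior v (grade_inv a) = - grade_inv (interior v a) :> ext R V.
Proof.
by apply/funext => s; rewrite /interior /grade_inv /= exprS mulN1r mulNr.
Qed.

Lemma interior_grade_inv v a :
  grade_inv (interior v a) = - interior v (grade_inv a) :> ext R V.
Proof. by rewrite grade_inv_interior opprK. Qed.

Lemma interior_wedge v a b : interior v (wedge a b) =
  (wedge (interior v a) b : ext R V) + wedge (grade_inv a) (interior v b) :> ext R V.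
Proof. by []. Qed.

Lemma wedgeDl : left_distributive (@wedge R V : ext R V -> ext R V -> ext R V) +%R.
Proof.
move=> a b c; apply/funext => s; elim: s a b c => [|v s IH] a b c.
  exact: mulrDl.
rewrite [(_ + _) (v :: s)]/(wedge a c (v :: s) + wedge b c (v :: s)) /=.
rewrite -!/(grade_inv _) interiorD grade_invD (IH _ _ c) (IH _ _ (interior v c)).
by rewrite addrACA.
Qed.

Lemma wedgeDr : right_distributive (@wedge R V : ext R V -> ext R V -> ext R V) +%R.
Proof.
move=> c a b; apply/funext => s; elim: s a b c => [|v s IH] a b c.
  exact: mulrDr.
rewrite [(_ + _) (v :: s)]/(wedge c a (v :: s) + wedge c b (v :: s)) /=.
rewrite -!/(grade_inv _) interiorD (IH _ _ (interior v c)) (IH _ _ (grade_inv c)).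
by rewrite addrACA.
Qed.

Lemma wedge0l a : wedge 0 a = 0 :> ext R V.
Proof.
by apply: (@addrI _ (wedge 0 a : ext R V)); rewrite -wedgeDl !addr0.
Qed.

Lemma wedge0r a : wedge a 0 = 0 :> ext R V.
Proof.
by apply: (@addrI _ (wedge a 0 : ext R V)); rewrite -wedgeDr !addr0.
Qed.

Lemma wedgeNl a b : wedge (- a) b = - (wedge a b : ext R V) :> ext R V.
Proof.
by apply: (@addrI _ (wedge a b : ext R V)); rewrite -wedgeDl !subrr wedge0l.
Qed.

Lemma wedgeNr a b : wedge a (- b) = - (wedge a b : ext R V) :> ext R V.
Proof.
by apply: (@addrI _ (wedge a b : ext R V)); rewrite -wedgeDr !subrr wedge0r.
Qed.

Lemma grade_inv_wedge a b :
  grade_inv (wedge a b) = wedge (grade_inv a) (grade_inv b).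
Proof.
apply/funext => s; elim: s a b => [|v s IH] a b.
  by rewrite /grade_inv /= !expr0 !mul1r.
rewrite -[LHS]/(interior v (grade_inv (wedge a b)) s) -[RHS]/(interior v _ s).
rewrite grade_inv_interior !interior_wedge grade_invD !grade_inv_interior.
rewrite wedgeNl wedgeNr -[RHS]/(- _ s - _ s) -[LHS]/(- (_ s + _ s)) opprD.
by rewrite !IH.
Qed.

(** Contraction is an antiderivation and the grading involution is multiplicative, so both
    bracketings expand into the same three products on a shorter list. *)
Lemma wedgeA : associative (@wedge R V : ext R V -> ext R V -> ext R V).
Proof.
move=> a b c; apply/funext => s; elim: s a b c => [|v s IH] a b c.
  by rewrite /= mulrA.
rewrite /= -!/(grade_inv _).
rewrite -/(interior v (wedge b c)) -/(interior v (wedge a b)) !interior_wedge.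
rewrite grade_inv_wedge wedgeDl wedgeDr.
by rewrite [X in _ + X = _]/(_ s + _ s) [X in _ = X + _]/(_ s + _ s) !IH addrA.
Qed.

Lemma grade_inv1 : grade_inv (@form1 R V) = @form1 R V.
Proof. by apply/funext => -[|v s]; rewrite /grade_inv /= ?mulr0 // mul1r. Qed.

Lemma wedge1l : left_id (@form1 R V : ext R V) (@wedge R V : ext R V -> ext R V -> ext R V).
Proof.
move=> a; apply/funext => s; elim: s a => [|v s IH] a; first by rewrite /= mul1r.
rewrite /= -!/(grade_inv _) grade_inv1 (_ : interior v _ = 0 :> ext R V) //.
by rewrite wedge0l IH [LHS]add0r.
Qed.

Lemma wedge1r : right_id (@form1 R V : ext R V) (@wedge R V : ext R V -> ext R V -> ext R V).
Proof.
move=> a; apply/funext => s; elim: s a => [|v s IH] a; first by rewrite /= mulr1.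
rewrite /= -!/(grade_inv _) (_ : interior v (@form1 R V) = 0 :> ext R V) //.
by rewrite wedge0r IH [LHS]addr0.
Qed.

End WedgeRing.

HB.instance Definition _ (R : pzRingType) (V : Type) :=
  GRing.Zmodule_isPzRing.Build (ext R V) (@wedgeA R V) (@wedge1l R V) (@wedge1r R V)
    (@wedgeDl R V) (@wedgeDr R V).

Section OneForms.
Variables (R : pzRingType) (V : Type).

Lemma wedge_cstl (c : R) (b : ext R V) s :
  wedge (fun u => if u is [::] then c else 0) b s = c * b s.
Proof.
elim: s b => [//|v s IH] b; set k := fun _ => _.
have k0 : grade_inv k = k.
  by apply/funext => -[|u l]; rewrite /grade_inv /k /= ?mulr0 // mul1r.
have ik : interior v k = 0 :> ext R V by [].
rewrite -[LHS]/(interior v (wedge k b) s) interior_wedge ik wedge0l k0 add0r.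
exact: IH.
Qed.

Lemma wedge_cstr (c : R) (b : ext R V) s :
  wedge b (fun u => if u is [::] then c else 0) s = b s * c.
Proof.
elim: s b => [//|v s IH] b; set k := fun _ => _.
have ik : interior v k = 0 :> ext R V by [].
rewrite -[LHS]/(interior v (wedge b k) s) interior_wedge ik wedge0r addr0.
exact: IH.
Qed.

(** The factors keep their order because the ring may be noncommutative: for the matrix-valued eta,
    the value of eta /\ eta is a commutator. *)
Lemma wedge_one_form (f g : V -> R) :
  wedge (one_form f) (one_form g) = two_form (fun u v => f u * g v - f v * g u).
Proof.
apply/funext => -[|u s]; first exact: mul0r.
transitivity (f u * one_form g s + (- one_form f s) * g u).
  rewrite -(wedge_cstl (f u) (one_form g)).
  rewrite -(wedge_cstr (g u) (- one_form f : ext R V)) /=; congr (_ + wedge _ _ s).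
  apply/funext => -[|v [|w l]]; rewrite -[RHS]/(- _) /= ?mulr0 ?oppr0 //.
  by rewrite mulN1r.
by case: s => [|v [|w s]] /=; rewrite ?mulr0 ?oppr0 ?mul0r ?addr0 // mulNr.
Qed.

End OneForms.

Section ExtAlgebra.
Variables (R : comNzRingType) (V : Type).
Implicit Types a b : ext R V.

Definition ext_scale (c : R) (a : ext R V) : ext R V := fun s => c * a s.

Fact ext_scaleA c d a : ext_scale c (ext_scale d a) = ext_scale (c * d) a.
Proof. by apply/funext => s; rewrite /ext_scale mulrA. Qed.
Fact ext_scale1 : left_id 1 ext_scale.
Proof. by move=> a; apply/funext => s; rewrite /ext_scale mul1r. Qed.
Fact ext_scaleDr : right_distributive ext_scale +%R.
Proof. by move=> c a b; apply/funext => s; exact: mulrDr. Qed.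
Fact ext_scaleDl a : {morph ext_scale^~ a : c d / c + d}.
Proof. by move=> c d; apply/funext => s; exact: mulrDl. Qed.

HB.instance Definition _ :=
  GRing.Zmodule_isLmodule.Build R (ext R V) ext_scaleA ext_scale1 ext_scaleDr ext_scaleDl.

Lemma extZE c a s : (c *: a) s = c * a s. Proof. by []. Qed.

Lemma interiorZ v c a : interior v (c *: a) = c *: (interior v a : ext R V) :> ext R V.
Proof. by []. Qed.

Lemma grade_invZ c a : grade_inv (c *: a) = c *: grade_inv a.
Proof. by apply/funext => s; rewrite /grade_inv !extZE mulrCA. Qed.

Fact ext_oner_neq0 : 1 != 0 :> ext R V.
Proof.
apply/eqP => /(congr1 (fun a : ext R V => a [::])).
by move/eqP; rewrite oner_eq0.
Qed.

HB.instance Definition _ := GRing.PzSemiRing_isNonZero.Build (ext R V) ext_oner_neq0.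

Fact ext_scaleAl c a b : c *: (a * b) = c *: a * b.
Proof.
apply/funext => s; elim: s a b => [|v s IH] a b; first exact: mulrA.
rewrite -[RHS]/(interior v (wedge (c *: a) b) s) interior_wedge.
rewrite interiorZ grade_invZ -[RHS]/((c *: (interior v a : ext R V) * b) s +
  (c *: grade_inv a * (interior v b : ext R V)) s).
by rewrite -!IH -mulrDr.
Qed.

HB.instance Definition _ := GRing.Lmodule_isLalgebra.Build R (ext R V) ext_scaleAl.

Fact ext_scaleAr c a b : c *: (a * b) = a * (c *: b).
Proof.
apply/funext => s; elim: s a b => [|v s IH] a b; first exact: mulrCA.
rewrite -[RHS]/(interior v (wedge a (c *: b)) s) interior_wedge.
rewrite interiorZ -[RHS]/(((interior v a : ext R V) * (c *: b)) s +
  (grade_inv a * (c *: (interior v b : ext R V))) s).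
by rewrite -!IH -mulrDr.
Qed.

HB.instance Definition _ := GRing.Lalgebra_isAlgebra.Build R (ext R V) ext_scaleAr.

End ExtAlgebra.

Definition ext1 (R : pzRingType) (V : Type) (f : V -> R) : ext R V := one_form f.
Definition iext (R : pzRingType) (V : Type) (v : V) (a : ext R V) : ext R V :=
  interior v a.

Section ExtTheory.
Variables (R : comNzRingType) (V : Type).
Implicit Types a b x : ext R V.

Lemma grade_invM a b : grade_inv (a * b) = grade_inv a * grade_inv b.
Proof. exact: grade_inv_wedge. Qed.

Lemma grade_inv_ext1 (f : V -> R) : grade_inv (ext1 f) = - ext1 f.
Proof.
apply/funext => -[|u [|v s]]; rewrite /grade_inv /ext1 -[RHS]/(- _) /=.
- by rewrite mulr0 oppr0.
- by rewrite mulN1r.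
- by rewrite mulr0 oppr0.
Qed.

Lemma iext_ext1 v (f : V -> R) : iext v (ext1 f) = f v *: 1.
Proof.
by apply/funext => -[|u s]; rewrite extZE /iext /ext1 ?mulr1 // mulr0.
Qed.

Lemma iextM v a b : iext v (a * b) = iext v a * b + grade_inv a * iext v b.
Proof. exact: interior_wedge. Qed.

Lemma iextZ v c a : iext v (c *: a) = c *: iext v a.
Proof. by []. Qed.

Lemma iext0 v : iext v 0 = 0 :> ext R V.
Proof. by []. Qed.

Lemma grade_inv_iext v a : grade_inv (iext v a) = - iext v (grade_inv a).
Proof. exact: interior_grade_inv. Qed.

Lemma extS v s a : a (v :: s) = iext v a s. Proof. by []. Qed.

(** Induction on the list: contracting either side gives [f v] times [x] minus an instance of the
    claim for a contraction of [x]. *)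
Lemma ext1_mulC (f : V -> R) x : ext1 f * x = grade_inv x * ext1 f.
Proof.
apply/funext => s; elim: s x => [|v s IH] x.
  by rewrite -[LHS]/(0 * x [::]) -[RHS]/(_ * 0) mul0r mulr0.
rewrite !extS !iextM iext_ext1 grade_inv_ext1 mulNr grade_invK.
rewrite -[iext v (grade_inv x)]opprK -grade_inv_iext mulNr.
rewrite -[LHS]/(_ s - _ s) -[RHS]/(- _ s + _ s) IH addrC -scalerAl mul1r.
by rewrite -scalerAr mulr1.
Qed.

Lemma ext1_anticomm (f g : V -> R) : ext1 f * ext1 g = - (ext1 g * ext1 f).
Proof. by rewrite ext1_mulC grade_inv_ext1 mulNr. Qed.

Lemma ext1M (f g : V -> R) :
  ext1 f * ext1 g = two_form (fun u v => f u * g v - f v * g u).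
Proof. exact: wedge_one_form. Qed.

Lemma ext1_sqr0 (f : V -> R) : ext1 f * ext1 f = 0.
Proof.
rewrite ext1M; apply/funext => -[|u [|v [|w s]]] //=.
by rewrite mulrC subrr.
Qed.

(** The two sign changes cancel. The curvature is a sum of products of two 1-forms, so it can be
    moved to the left of p_i. *)
Lemma ext2_comm (f g : V -> R) x :
  ext1 f * ext1 g * x = x * (ext1 f * ext1 g).
Proof. by rewrite -mulrA (ext1_mulC g) mulrA (ext1_mulC f) grade_invK mulrA. Qed.

End ExtTheory.

(** * Contractions of the volume form of a dual basis *)

Section Volume.
Variables (R : comNzRingType) (V : Type) (k : nat).
Variables (alpha : 'I_k -> V -> R) (x : 'I_k -> V).
Hypothesis dual : forall i j, alpha i (x j) = (i == j)%:R.

Definition vol : ext R V := \prod_(i < k) ext1 (alpha i).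

Lemma grade_inv_vol : grade_inv vol = (-1) ^+ k *: vol.
Proof.
rewrite /vol; elim: k alpha => [|l IH] f.
  by rewrite !big_ord0 expr0 scale1r; exact: grade_inv1.
rewrite !big_ord_recl grade_invM grade_inv_ext1 IH -scalerAr mulNr.
by rewrite exprS mulN1r scaleNr scalerN.
Qed.

Lemma ext1_vol i : ext1 (alpha i) * vol = 0.
Proof.
rewrite /vol.
suff: forall l (f : 'I_l -> V -> R) (j : 'I_l), ext1 (f j) * \prod_(i < l) ext1 (f i) = 0.
  by apply.
elim=> [|l IH] f j; first by case: j.
rewrite big_ord_recl mulrA; case: (unliftP ord0 j) => [j'|] ->.
  by rewrite ext1_anticomm mulNr -mulrA IH mulr0 oppr0.
by rewrite ext1_sqr0 mul0r.
Qed.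

(** Contract alpha_i /\ vol = 0 with x_j; contracting the result once more gives [ext1_iext2_vol].
    The product defining vol is never expanded. *)
Lemma ext1_iext_vol i j : ext1 (alpha i) * iext (x j) vol = (i == j)%:R *: vol.
Proof.
have := congr1 (iext (x j)) (ext1_vol i).
rewrite iextM iext_ext1 grade_inv_ext1 -scalerAl mul1r mulNr dual iext0.
by move/eqP; rewrite subr_eq0 => /eqP <-.
Qed.

Lemma ext1_iext2_vol i a b :
  ext1 (alpha i) * iext (x b) (iext (x a) vol) =
  (i == b)%:R *: iext (x a) vol - (i == a)%:R *: iext (x b) vol.
Proof.
have := congr1 (iext (x b)) (ext1_iext_vol i a).
rewrite iextM iext_ext1 grade_inv_ext1 -scalerAl mul1r mulNr dual iextZ.
by move=> <-; rewrite opprB addrC subrK.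
Qed.

End Volume.

Section Pullback.
Variables (R : comNzRingType) (V W : Type) (f : V -> W).

Definition pull (a : ext R W) : ext R V := pullback f a.

Lemma pull_ext1 (u : W -> R) : pull (ext1 u) = ext1 (u \o f).
Proof. by apply/funext => -[|v [|w s]]. Qed.

Lemma pullM (a b : ext R W) : pull (a * b) = pull a * pull b.
Proof.
apply/funext => s; elim: s a b => [//|v s IH] a b.
rewrite [RHS]extS iextM.
rewrite -[LHS]/(pull (iext (f v) (a * b)) s) iextM.
rewrite -[LHS]/(pull (_ * _) s + pull (_ * _) s) !IH.
have -> : pull (grade_inv a) = grade_inv (pull a) by
  apply/funext => u; rewrite /pull /pullback /grade_inv size_map.
by [].
Qed.

Lemma pull0 : pull 0 = 0. Proof. by []. Qed.
Lemma pullZ c (a : ext R W) : pull (c *: a) = c *: pull a. Proof. by []. Qed.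
Lemma pullB (a b : ext R W) : pull (a - b) = pull a - pull b. Proof. by []. Qed.

End Pullback.

(** * The product of a momentum with a curvature *)

Section MomentumCurvature.
Variables (R : numFieldType) (V W : Type) (n r : nat) (f : V -> W).
Variables (b : 'I_n -> W -> R) (c : 'I_r -> W -> R).
Variables (e : 'I_n -> W) (rho : 'I_r -> W).
Hypothesis be : forall i j, b i (e j) = (i == j)%:R.
Hypothesis crho : forall i j, c i (rho j) = (i == j)%:R.
Variables (p : 'I_n -> 'I_n -> R) (q : 'I_n -> 'I_r -> R).
Hypothesis p_asym : forall i j, p i j + p j i = 0.

Let B i : ext R V := ext1 (b i \o f).
Let C j : ext R V := ext1 (c j \o f).
Let beta : ext R V := pull f (vol b).
Let gamma : ext R V := pull f (vol c).
Let beta1 i : ext R V := pull f (iext (e i) (vol b)).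
Let beta2 i j : ext R V := pull f (iext (e j) (iext (e i) (vol b))).
Let gamma1 j : ext R V := pull f (iext (rho j) (vol c)).

Definition momentum : ext R V :=
  - (2^-1 *: \sum_i \sum_j p i j *: (beta2 i j * gamma))
  + (-1) ^+ n *: \sum_i \sum_j q i j *: (beta1 i * gamma1 j).

(** The two terms of beta^k /\ beta_ij contribute the same sum by antisymmetry of [p], each with
    coefficient 1/2. *)
Lemma ext1_momentum k : B k * momentum =
  \sum_j p k j *: (beta1 j * gamma) + (-1) ^+ n *: \sum_j q k j *: (beta * gamma1 j).
Proof.
rewrite /momentum mulrDr mulrN -!scalerAr; congr (_ + _ *: _).
  have E i j : B k * (p i j *: (beta2 i j * gamma)) =
      (k == j)%:R *: (p i j *: (beta1 i * gamma))
      - (k == i)%:R *: (p i j *: (beta1 j * gamma)).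
    rewrite -scalerAr mulrA /B -pull_ext1 -pullM (ext1_iext2_vol be) pullB !pullZ.
    by rewrite mulrBl -!scalerAl scalerBr !scalerA ![p i j * _]mulrC.
  have D (T : 'I_n -> ext R V) : \sum_i (k == i)%:R *: T i = T k.
    rewrite (bigD1 k) //= eqxx scale1r big1 ?addr0 // => i /negPf ik.
    by rewrite eq_sym ik scale0r.
  rewrite big_distrr /=.
  under eq_bigr => i _ do (rewrite big_distrr /=;
    under eq_bigr => j _ do rewrite E; rewrite big_split /= sumrN D -scaler_sumr).
  rewrite big_split /= sumrN D.
  rewrite (_ : \sum_i p i k *: (beta1 i * gamma) = - \sum_j p k j *: (beta1 j * gamma)).
    rewrite -opprD scalerN opprK -mulr2n -[X in _ *: X]scaler_nat scalerA mulVf ?scale1r //.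
  rewrite -sumrN; apply: eq_bigr => i _.
  by rewrite -scaleNr; congr (_ *: _); apply/eqP; rewrite -addr_eq0 p_asym.
have E i j : B k * (q i j *: (beta1 i * gamma1 j)) =
    (k == i)%:R *: (q i j *: (beta * gamma1 j)).
  rewrite -scalerAr mulrA /B -pull_ext1 -pullM (ext1_iext_vol be) pullZ.
  by rewrite -scalerAl !scalerA mulrC.
rewrite big_distrr /= (bigD1 k) //= [X in _ + X]big1 => [|i /negPf ik].
  rewrite addr0 big_distrr /=; apply: eq_bigr => j _.
  by rewrite E eqxx scale1r.
by rewrite big_distrr /= big1 // => j _; rewrite E eq_sym ik scale0r.
Qed.

(** A second factor beta^l kills the part in beta /\ gamma_j, since beta already contains beta^l. *)
Lemma ext1_ext1_momentum k l : B l * B k * momentum = p k l *: (beta * gamma).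
Proof.
rewrite -mulrA ext1_momentum mulrDr -scalerAr !big_distrr /=.
rewrite [X in _ *: X]big1 => [|j _].
  rewrite scaler0 addr0 (bigD1 l) //= big1 => [|j /negPf jl].
    rewrite addr0 -scalerAr mulrA /B -pull_ext1 -pullM (ext1_iext_vol be).
    by rewrite eqxx scale1r.
  rewrite -scalerAr mulrA /B -pull_ext1 -pullM (ext1_iext_vol be).
  by rewrite eq_sym jl scale0r pull0 mul0r scaler0.
by rewrite -scalerAr mulrA /B -pull_ext1 -pullM ext1_vol pull0 mul0r scaler0.
Qed.

(** Here gamma^l kills the part containing gamma. In the other part it passes beta, and the
    resulting (-1)^n cancels the sign in [momentum]; the minus sign comes from exchanging beta^k and
    gamma^l. *)
Lemma ext1_gamma_momentum k l : B k * C l * momentum = - q k l *: (beta * gamma).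
Proof.
have Cvol : C l * gamma = 0.
  by rewrite /C -pull_ext1 -pullM ext1_vol.
rewrite /B /C ext1_anticomm mulNr -mulrA ext1_momentum mulrDr -scalerAr !big_distrr /=.
rewrite big1 => [|j _]; last first.
  by rewrite -scalerAr mulrA ext1_mulC -mulrA Cvol mulr0 scaler0.
rewrite add0r scaleNr; congr (- _).
have E j : C l * (q k j *: (beta * gamma1 j)) =
    (l == j)%:R *: (q k j *: ((-1) ^+ n *: (beta * gamma))).
  rewrite -scalerAr mulrA {1}/C -pull_ext1 -pullM ext1_mulC grade_inv_vol.
  rewrite -scalerAl pullZ pullM -scalerAl -mulrA -pullM (ext1_iext_vol crho).
  rewrite pullZ -scalerAr !scalerA; congr (_ *: _).
  by rewrite mulrC mulrA.
rewrite (bigD1 l) //= big1 => [|j /negPf jl]; last by rewrite E eq_sym jl scale0r.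
by rewrite addr0 E eqxx scale1r !scalerA mulrAC -expr2 sqrr_sign mul1r.
Qed.

Lemma momentum_curvature (X : 'I_n -> V -> R) (F : 'I_n -> 'I_n -> R)
    (L : 'I_n -> 'I_r -> R) :
  momentum * (\sum_i ext1 (X i) * B i
     + 2^-1 *: \sum_i \sum_j F i j *: (B i * B j)
     + \sum_i \sum_j L i j *: (B i * C j)) =
  \sum_i \sum_j p i j *: (ext1 (X i) * (beta1 j * gamma))
  + (-1) ^+ n *: \sum_i \sum_j q i j *: (ext1 (X i) * (beta * gamma1 j))
  - (2^-1 * (\sum_i \sum_j p i j * F i j) + \sum_i \sum_j q i j * L i j)
    *: (beta * gamma).
Proof.
rewrite !mulrDr scalerDl opprD addrA; congr (_ + _ + _).
- rewrite big_distrr scaler_sumr -big_split /=; apply: eq_bigr => i _.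
  rewrite -ext2_comm -mulrA ext1_momentum mulrDr -scalerAr !big_distrr /=.
  by congr (_ + _ *: _); apply: eq_bigr => j _; rewrite -scalerAr.
- rewrite -scalerAr -scalerA -scalerN; congr (_ *: _).
  rewrite big_distrr /= scaler_suml -sumrN; apply: eq_bigr => i _.
  rewrite big_distrr /= scaler_suml -sumrN; apply: eq_bigr => j _.
  rewrite -scalerAr -ext2_comm ext1_ext1_momentum scalerA -scaleNr; congr (_ *: _).
  (* Multiplication by beta^i /\ beta^j has produced the coefficient [p j i], with its indices
     exchanged. *)
  have /eqP := p_asym i j; rewrite addr_eq0 => /eqP ->.
  by rewrite mulNr opprK mulrC.
- rewrite big_distrr /= scaler_suml -sumrN; apply: eq_bigr => i _.
  rewrite big_distrr /= scaler_suml -sumrN; apply: eq_bigr => j _.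
  rewrite -scalerAr -ext2_comm ext1_gamma_momentum scalerA -scaleNr; congr (_ *: _).
  by rewrite mulrN mulrC.
Qed.

End MomentumCurvature.

(** * Calculus in normed spaces *)

Section Differentiability.
Variable R : realType.
Implicit Types V W X : normedModType R.

Lemma near_eq_differentiable V W (f h : V -> W) x :
  {near x, f =1 h} -> differentiable f x -> differentiable h x.
Proof.
move=> fh df.
rewrite -(subrK f h); apply: differentiableD => //.
(* It remains to treat a function that vanishes near x: the zero map satisfies the defining estimate
   of its differential. *)
set k := h - f.
have k0 : \forall y \near x, k y = 0.
  by near=> y; rewrite /k -[LHS]/(h y - f y) (near fh y) ?subrr.
have kx : k x = 0 by exact: nbhs_singleton k0.
have kE : k \o shift x = cst (k x) + (0 : V -> W) +o_ 0 id.
  apply/eqaddoP => _/posnumP[eps]; near=> y.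
  rewrite -[X in `|X|]/((k (y + x) - (k x + 0))) kx addr0 subr0.
  suff -> : k (y + x) = 0 by rewrite normr0 mulr_ge0.
  by near: y; move: k0; rewrite (near_shift 0) /= subr0.
have dk0 : 'd k x = 0 :> (V -> W).
  apply: (@diff_unique _ _ _ k (\0 : {linear V -> W}) x) => //.
  exact: cst_continuous.
apply/diff_locallyP; rewrite dk0; split => //.
exact: cst_continuous.
Unshelve. all: by end_near. Qed.

Lemma differentiable_entry V a b (F : V -> 'M[R]_(a, b)) x i j :
  differentiable F x -> differentiable (fun y => F y i j) x.
Proof.
move=> dF; apply: (@differentiable_comp _ _ _ _ F (fun N : 'M[R]_(a, b) => N i j)) => //.
exact: differentiable_coord.
Qed.

Lemma differentiable_mx V a b (F : V -> 'M[R]_(a, b)) x :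
  (forall i j, differentiable (fun y => F y i j) x) -> differentiable F x.
Proof.
move=> dF.
rewrite (_ : F = \sum_i \sum_j (fun y => F y i j *: delta_mx i j)).
  by do 2!apply: differentiable_sum => ?; exact: differentiableZl.
apply/funext => y; rewrite {1}[F y]matrix_sum_delta fct_sumE; apply: eq_bigr => i _.
by rewrite fct_sumE.
Qed.

Lemma derive_entry V a b (F : V -> 'M[R]_(a, b)) x v i j :
  differentiable F x -> 'D_v F x i j = 'D_v (fun y => F y i j) x.
Proof. by move=> dF; rewrite derive_mx ?mxE //; exact: diff_derivable. Qed.

Lemma derive_linear V W (f : V -> W) x :
  differentiable f x -> linear (fun v => 'D_v f x).
Proof. by move=> df c u v; rewrite !deriveE // linearP. Qed.

Lemma derive_comp V W X (f : V -> W) (h : W -> X) x v :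
  differentiable f x -> differentiable h (f x) ->
  'D_v (h \o f) x = 'D_('D_v f x) h (f x).
Proof.
move=> df dh.
have dhf : differentiable (h \o f) x by exact: differentiable_comp.
by rewrite (deriveE _ dhf) (deriveE _ dh) (deriveE _ df) diff_comp.
Qed.

Lemma differentiable_mulmx V a b c (F : V -> 'M[R]_(a, b)) (H : V -> 'M[R]_(b, c)) x :
  differentiable F x -> differentiable H x ->
  differentiable (fun y => F y *m H y) x.
Proof.
move=> dF dH; apply: differentiable_mx => i j.
rewrite (_ : (fun _ => _) = \sum_k ((fun y => F y i k) * (fun y => H y k j))).
  by apply: differentiable_sum => k; apply: differentiableM; exact: differentiable_entry.
by apply/funext => y; rewrite mxE fct_sumE.
Qed.

Lemma derive_mulmx V a b c (F : V -> 'M[R]_(a, b)) (H : V -> 'M[R]_(b, c)) x v :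
  differentiable F x -> differentiable H x ->
  'D_v (fun y => F y *m H y) x = 'D_v F x *m H x + F x *m 'D_v H x.
Proof.
move=> dF dH; apply/matrixP => i j.
have dFe k : derivable (fun y => F y i k) x v.
  by apply: diff_derivable; exact: differentiable_entry.
have dHe k : derivable (fun y => H y k j) x v.
  by apply: diff_derivable; exact: differentiable_entry.
rewrite derive_entry; last exact: differentiable_mulmx.
rewrite (_ : (fun _ => _) = \sum_k ((fun y => F y i k) * (fun y => H y k j))); last first.
  by apply/funext => y; rewrite mxE fct_sumE.
rewrite derive_sum; last by move=> k; exact: derivableM.
rewrite !mxE -big_split /=; apply: eq_bigr => k _.
rewrite deriveM // !derive_entry // addrC; congr (_ + _).
by rewrite -[LHS]/(_ * _) mulrC.
Qed.

Lemma differentiable_scale V a b (c : V -> R) (F : V -> 'M[R]_(a, b)) x :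
  differentiable c x -> differentiable F x ->
  differentiable (fun y => c y *: F y) x.
Proof.
move=> dc dF; apply: differentiable_mx => i j.
rewrite (_ : (fun _ => _) = c * (fun y => F y i j)).
  by apply: differentiableM => //; exact: differentiable_entry.
by apply/funext => y; rewrite mxE.
Qed.

Lemma derive_scale V a b (c : V -> R) (F : V -> 'M[R]_(a, b)) x v :
  differentiable c x -> differentiable F x ->
  'D_v (fun y => c y *: F y) x = 'D_v c x *: F x + c x *: 'D_v F x.
Proof.
move=> dc dF; apply/matrixP => i j.
rewrite derive_entry; last exact: differentiable_scale.
rewrite (_ : (fun _ => _) = c * (fun y => F y i j)); last first.
  by apply/funext => y; rewrite mxE.
rewrite deriveM; [|exact: diff_derivable|by apply: diff_derivable; exact: differentiable_entry].
rewrite !mxE derive_entry // addrC; congr (_ + _); exact: mulrC.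
Qed.

End Differentiability.

(** * Symmetry of second derivatives, and functions of class C^2 *)

Section Young.
Variable R : realType.
Implicit Types V W X : normedModType R.

(* Young's theorem: the second difference is symmetric in u and v, and by the mean
   value theorem its limit is D_v (D_u f). *)
Lemma second_difference V (f : V -> R) x u v e :
  (\forall y \near x, differentiable f y) ->
  differentiable (fun y => 'D_u f y) x -> 0 < e ->
  \forall s \near 0^'+, `|(f (x + s *: u + s *: v) - f (x + s *: u)
      - f (x + s *: v) + f x) / s ^+ 2 - 'D_v (fun y => 'D_u f y) x| <= e.
Proof.
move=> df dDf e0; set G := fun y => 'D_u f y.
(* The two first-order errors below, at a u + s v and at a u with 0 <= a <= s, add up to at most e /
   K times s (2 |u| + |v|). The summand 1 keeps K positive. *)
pose K := 1 + 2 * `|u| + `|v|.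
have K0 : 0 < K by rewrite /K -addrA ltr_wpDr // addr_ge0 ?mulr_ge0.
have eK : 0 < e / K by rewrite divr_gt0.
have [d /= d0 Hd] : exists2 d, 0 < d & forall h, `|h| < d ->
    differentiable f (x + h) /\ `|G (x + h) - G x - 'd G x h| <= e / K * `|h|.
  have /diff_locallyP[_] := dDf.
  move=> /eqaddoP /(_ _ eK) o1.
  move: df; rewrite (near_shift 0) /= => df.
  have [d /= d0 Hd] := proj1 (nbhs_normP _ _) (filterI o1 df).
  exists d => // h hd; have [|A B] := Hd h; first by rewrite /= sub0r normrN.
  rewrite addrC; split; first by move: B; rewrite subr0.
  by rewrite -addrA -opprD; exact: A.
near=> s.
have s0 : 0 < s by near: s; by apply: nbhs_right_gt.
have sd : s * (`|u| + `|v|) < d.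
  have w0 : 0 < `|u| + `|v| + 1 by rewrite ltr_wpDl // addr_ge0.
  apply: (@le_lt_trans _ _ (s * (`|u| + `|v| + 1))).
    by apply: ler_wpM2l; [exact: ltW|rewrite lerDl].
  rewrite -ltr_pdivlMr //; near: s; apply: nbhs_right_lt; exact: divr_gt0.
pose phi (z : V) (a : R) := f (a *: u + (x + z)).
have dphi z a : `|a *: u + z| < d -> is_derive a 1 (phi z) (G (x + (a *: u + z))).
  move=> az.
  have aff (b : R) : is_diff b (fun b : R => b *: u + (x + z)) (fun b => b *: u).
    rewrite (_ : (fun b => b *: u) = (fun b => b *: u) + (0 : R -> V)); last by rewrite addr0.
    exact: (is_diffD (is_diff_scalel _ _) (is_diff_cst (x + z) b)).
  have daff : differentiable (fun b : R => b *: u + (x + z)) a by apply: ex_diff.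
  have df' : differentiable f (a *: u + (x + z)).
    by rewrite addrCA; case: (Hd _ az).
  apply: DeriveDef.
    apply: diff_derivable.
    exact: (@differentiable_comp _ _ _ _ (fun b : R => b *: u + (x + z)) f).
  rewrite -[phi z]/(f \o (fun b : R => b *: u + (x + z))) derive_comp //.
  by rewrite [X in 'D_X f _]deriveE // diff_val scale1r /G addrCA.
have bnd a (z : V) : 0 <= a <= s -> `|z| <= s * `|v| -> `|a *: u + z| < d.
  case/andP=> a0 as_ zv; apply: le_lt_trans sd; rewrite mulrDr.
  apply: (le_trans (ler_normD _ _)); rewrite lerD // normrZ ger0_norm //.
  by rewrite ler_wpM2r.
have n0 : `|0 : V| <= s * `|v| by rewrite normr0 mulr_ge0 // ltW.
have nv : `|s *: v| <= s * `|v| by rewrite normrZ gtr0_norm.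
(* The second difference is g s - g 0. One use of the mean value theorem, along u, leaves two values
   of D_u f, which are compared through the differential of D_u f at x. *)
pose g a := phi (s *: v) a - phi 0 a.
have dg a : 0 <= a <= s -> is_derive a 1 g (G (x + (a *: u + s *: v)) - G (x + (a *: u + 0))).
  by move=> as_; apply: is_deriveB; apply: dphi; exact: bnd.
have [|a as_|a ab] := MVT s0 (f := g)
  (df := fun a => G (x + (a *: u + s *: v)) - G (x + (a *: u + 0))).
- by move=> a; rewrite in_itv /= => /andP[a0 as_]; apply: dg; rewrite !ltW.
- apply: derivable_within_continuous => b; rewrite in_itv /= => /dg bs.
  exact: ex_derive.
rewrite subr0 => gs.
have as_ : 0 <= a <= s by move: ab; rewrite in_itv /= => /andP[? ?]; rewrite !ltW.
have -> : f (x + s *: u + s *: v) - f (x + s *: u) - f (x + s *: v) + f x = g s - g 0.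
  rewrite /g /phi !scale0r !add0r !addr0 opprB.
  rewrite [s *: u + (x + _)]addrA [s *: u + x]addrC.
  rewrite -!addrA; do 2!congr (_ + _); by rewrite addrC.
rewrite gs expr2 invfM mulrA mulfK ?gt_eqF //.
rewrite -(@ler_pM2r _ s) // -[X in _ * X <= _](gtr0_norm s0) -normrM mulrBl divfK ?gt_eqF //.
have [_ E1] := Hd _ (bnd _ _ as_ nv); have [_ E2] := Hd _ (bnd _ _ as_ n0).
have -> : 'D_v G x * s = 'd G x (a *: u + s *: v) - 'd G x (a *: u + 0).
  by rewrite deriveE // -linearB addr0 addrAC subrr add0r linearZ -[RHS]/(_ * _) mulrC.
set A := G (x + _) in E1 *; set B := G (x + _) in E2 *.
have -> : A - B - ('d G x (a *: u + s *: v) - 'd G x (a *: u + 0)) =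
  (A - G x - 'd G x (a *: u + s *: v)) - (B - G x - 'd G x (a *: u + 0)) by lra.
apply: (le_trans (ler_normB _ _)); apply: (le_trans (lerD E1 E2)).
rewrite -mulrDr -mulrA ler_pM2l // mulrC -ler_pdivlMr ?invr_gt0 // invrK.
rewrite addr0 normrZ.
have /andP[a0 as'] := as_; rewrite (ger0_norm a0).
have := ler_normD (a *: u) (s *: v); rewrite !normrZ (ger0_norm a0) (gtr0_norm s0).
have : a * `|u| <= s * `|u| by rewrite ler_wpM2r.
rewrite /K => H1 H2.
suff : 0 <= s by nra.
exact: ltW.
Unshelve. all: by end_near. Qed.

Lemma derive_comm V (f : V -> R) x u v :
  (\forall y \near x, differentiable f y) ->
  differentiable (fun y => 'D_u f y) x -> differentiable (fun y => 'D_v f y) x ->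
  'D_v (fun y => 'D_u f y) x = 'D_u (fun y => 'D_v f y) x.
Proof.
move=> df du dv; apply/eqP; rewrite -subr_eq0 -normr_le0.
apply/ler_addgt0Pr => e e0; rewrite add0r.
have e2 : 0 < e / 2 by rewrite divr_gt0.
(* A common s for both orders of u and v. The second difference is the same for both, so the two
   derivatives lie within e / 2 of one number. *)
have [s [A B]] := filter_ex
  (filterI (second_difference v df du e2) (second_difference u df dv e2)).
move: B; rewrite [x + s *: v + _]addrAC [f _ - f (x + s *: v) - _]addrAC.
move: A; set q := _ / _.
move: ('D_v _ x) ('D_u _ x) => P Q A B.
have -> : P - Q = (q - Q) - (q - P) by ring.
rewrite [e]splitr.
by apply: (le_trans (ler_normB _ _)); exact: lerD.
Qed.

(* C^2 rather than C^oo: this is all that symmetry of second derivatives needs, and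
   its stability under composition takes one application of the chain rule. *)
Definition C2_near V W (f : V -> W) (x : V) : Prop :=
  \forall y \near x, differentiable f y /\
    forall v, differentiable (fun z => 'D_v f z) y.

Lemma smooth_C2 V W (f : V -> W) x : smooth_near f x -> C2_near f x.
Proof.
apply: filterS => y sf; split; first exact: (sf [::]).
by move=> v; exact: (sf [:: v]).
Qed.

Lemma C2_near_near V W (f : V -> W) x : C2_near f x -> \forall y \near x, C2_near f y.
Proof. by move/near_join. Qed.

Lemma C2_near_diff V W (f : V -> W) x : C2_near f x -> differentiable f x.
Proof. by move/nbhs_singleton => []. Qed.

Lemma C2_near_diff2 V W (f : V -> W) x v :
  C2_near f x -> differentiable (fun z => 'D_v f z) x.
Proof. by move/nbhs_singleton => []. Qed.

Lemma near_eq_C2 V W (f h : V -> W) x : {near x, f =1 h} -> C2_near f x -> C2_near h x.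
Proof.
move=> fh c2; near=> y.
have fhy : {near y, f =1 h} by near: y; exact: near_join.
have c2y : C2_near f y by near: y; exact: C2_near_near.
split; first exact: near_eq_differentiable (C2_near_diff c2y).
move=> v; apply: near_eq_differentiable (C2_near_diff2 v c2y).
have := near_join fhy; apply: filterS => z fhz.
exact: near_eq_derive.
Unshelve. all: by end_near. Qed.

Lemma C2_entry V a b (F : V -> 'M[R]_(a, b)) x i j :
  C2_near F x -> C2_near (fun y => F y i j) x.
Proof.
move=> /C2_near_near; apply: filterS => y c2; split.
  by apply: differentiable_entry; exact: C2_near_diff.
move=> v; have dv := C2_near_diff2 v c2.
apply: near_eq_differentiable (differentiable_entry i j dv).
apply: filterS c2 => z [dz _]; exact: derive_entry.
Qed.

Lemma C2_mulmx V a b c (F : V -> 'M[R]_(a, b)) (H : V -> 'M[R]_(b, c)) x :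
  C2_near F x -> C2_near H x -> C2_near (fun y => F y *m H y) x.
Proof.
move=> /C2_near_near cF /C2_near_near cH; near=> y.
have cFy : C2_near F y by near: y.
have cHy : C2_near H y by near: y.
split; first by apply: differentiable_mulmx; exact: C2_near_diff.
move=> v; apply: (near_eq_differentiable
  (f := (fun z => 'D_v F z *m H z) + (fun z => F z *m 'D_v H z))).
  near=> z; rewrite derive_mulmx //.
    by apply: C2_near_diff; near: z; exact: C2_near_near.
  by apply: C2_near_diff; near: z; exact: C2_near_near.
by apply: differentiableD; apply: differentiable_mulmx;
  do [exact: C2_near_diff2 | exact: C2_near_diff].
Unshelve. all: by end_near. Qed.

(** In the derivative of a composite [h \o f] the direction ['D_v f z] moves with z, whereas
    [C2_near] controls derivatives of h in fixed directions only. Expanding along the standard basis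
    fixes the directions. *)
Lemma derive_coord V k a b (h : 'rV[R]_k -> 'M[R]_(a, b)) y v :
  differentiable h y -> 'D_v h y = \sum_i v 0 i *: 'D_(delta_mx 0 i) h y.
Proof.
move=> dh; rewrite deriveE // {1}[v]row_sum_delta linear_sum; apply: eq_bigr => i _.
by rewrite linearZ /= deriveE.
Qed.

Lemma C2_comp V k a b (f : V -> 'rV[R]_k) (h : 'rV[R]_k -> 'M[R]_(a, b)) x :
  C2_near f x -> C2_near h (f x) -> C2_near (h \o f) x.
Proof.
move=> cf ch.
have cont : {for x, continuous f} by apply: differentiable_continuous; exact: C2_near_diff.
have ch' : \forall y \near x, C2_near h (f y) by exact: (cont _ (C2_near_near ch)).
have cf' := C2_near_near cf.
near=> y.
have cfy : C2_near f y by near: y.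
have chy : C2_near h (f y) by near: y.
have dcomp z : differentiable f z -> differentiable h (f z) -> differentiable (h \o f) z.
  by move=> *; exact: differentiable_comp.
split; first by apply: dcomp; exact: C2_near_diff.
move=> v; apply: (near_eq_differentiable
  (f := \sum_i (fun z => ('D_v f z) 0 i *: ('D_(delta_mx 0 i) h \o f) z))).
  have chy' : \forall z \near y, C2_near h (f z).
    by near: y; exact: near_join.
  near=> z.
  have dfz : differentiable f z by apply: C2_near_diff; near: z; exact: C2_near_near.
  have dhz : differentiable h (f z) by apply: C2_near_diff; near: z.
  by rewrite derive_comp // derive_coord // fct_sumE.
apply: differentiable_sum => i; apply: differentiable_scale.
  by apply: differentiable_entry; exact: C2_near_diff2.
apply: differentiable_comp; first exact: C2_near_diff.
exact: C2_near_diff2.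
Unshelve. all: by end_near. Qed.

Lemma C2_derive_entry V a b (F : V -> 'M[R]_(a, b)) x u v i j : C2_near F x ->
  'D_v (fun y => 'D_u F y) x i j = 'D_v (fun y => 'D_u (fun z => F z i j) y) x.
Proof.
move=> cF; have du := C2_near_diff2 u cF.
transitivity ('D_v (fun y => 'D_u F y i j) x); first exact: (derive_entry v i j du).
apply: near_eq_derive; apply: filterS cF => z [dz _]; exact: derive_entry.
Qed.

Lemma C2_derive_comm V a b (F : V -> 'M[R]_(a, b)) x u v :
  C2_near F x -> 'D_v (fun y => 'D_u F y) x = 'D_u (fun y => 'D_v F y) x.
Proof.
move=> cF; apply/matrixP => i j.
have cFij := C2_entry i j cF.
transitivity ('D_v (fun y => 'D_u (fun z => F z i j) y) x).
  exact: C2_derive_entry.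
transitivity ('D_u (fun y => 'D_v (fun z => F z i j) y) x).
  apply: derive_comm; [|exact: C2_near_diff2|exact: C2_near_diff2].
  by apply: filterS cFij => z [].
exact/esym/C2_derive_entry.
Qed.

End Young.

(** * Differentiating the inverse of a matrix *)

Section InverseMatrix.
Variables (R : realType) (V : normedModType R).

Lemma differentiable_bigsum (I : Type) (s : seq I) (f : I -> V -> R) x :
  (forall i, differentiable (f i) x) -> differentiable (fun y => \sum_(i <- s) f i y) x.
Proof.
move=> df; elim: s => [|i s IH].
  rewrite (_ : (fun _ => _) = cst 0) //; by apply/funext => y; rewrite big_nil.
rewrite (_ : (fun _ => _) = f i + (fun y => \sum_(i <- s) f i y)).
  exact: differentiableD.
by apply/funext => y; rewrite big_cons.
Qed.

Lemma differentiable_bigprod (I : Type) (s : seq I) (f : I -> V -> R) x :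
  (forall i, differentiable (f i) x) -> differentiable (fun y => \prod_(i <- s) f i y) x.
Proof.
move=> df; elim: s => [|i s IH].
  rewrite (_ : (fun _ => _) = cst 1) //; by apply/funext => y; rewrite big_nil.
rewrite (_ : (fun _ => _) = f i * (fun y => \prod_(i <- s) f i y)).
  exact: differentiableM.
by apply/funext => y; rewrite big_cons.
Qed.

Lemma differentiable_det n (F : V -> 'M[R]_n) x :
  differentiable F x -> differentiable (fun y => \det (F y)) x.
Proof.
move=> dF; apply: differentiable_bigsum => s.
rewrite (_ : (fun _ => _) = cst ((-1) ^+ odd_perm s) * (fun y => \prod_i F y i (s i))) //.
apply: differentiableM => //; apply: differentiable_bigprod => i.
exact: differentiable_entry.
Qed.

Lemma differentiable_adj n (F : V -> 'M[R]_n) x :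
  differentiable F x -> differentiable (fun y => \adj (F y)) x.
Proof.
move=> dF; apply: differentiable_mx => i j.
rewrite (_ : (fun _ => _) = cst ((-1) ^+ (j + i)) * (fun y => \det (row' j (col' i (F y))))).
  apply: differentiableM => //; apply: differentiable_det.
  apply: differentiable_mx => k l.
  rewrite (_ : (fun _ => _) = (fun y => F y (lift j k) (lift i l))).
    exact: differentiable_entry.
  by apply/funext => y; rewrite !mxE.
by apply/funext => y; rewrite mxE.
Qed.

Lemma near_unitmx n (F : V -> 'M[R]_n) x : differentiable F x -> F x \in unitmx ->
  \forall y \near x, F y \in unitmx.
Proof.
move=> dF; rewrite unitmxE unitfE => Fx.
have cd := differentiable_continuous (differentiable_det dF).
have detn : \forall y \near x, \det (F y) != 0 := cvgr_neq0 _ cd Fx.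
near=> y; rewrite unitmxE unitfE; near: y; exact: detn.
Unshelve. all: by end_near. Qed.

Lemma differentiable_invmx n (F : V -> 'M[R]_n) x : differentiable F x ->
  F x \in unitmx -> differentiable (fun y => invmx (F y)) x.
Proof.
move=> dF Fx.
(* Cramer's formula describes [invmx] only at invertible matrices, but invertibility persists near
   x. *)
apply: (near_eq_differentiable (f := fun y => (\det (F y))^-1 *: \adj (F y))).
  by apply: filterS (near_unitmx dF Fx) => y Fy; rewrite /invmx Fy.
apply: differentiable_scale; last exact: differentiable_adj.
apply: differentiableV; first exact: differentiable_det.
by rewrite -unitfE -unitmxE.
Qed.

(** Differentiate H F = 1 and multiply on the right by H, which is also a right inverse of F at
    x. *)
Lemma derive_left_inverse n (F H : V -> 'M[R]_n) x v :
  differentiable F x -> differentiable H x -> (\forall y \near x, H y *m F y = 1%:M) ->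
  'D_v H x = - (H x *m 'D_v F x *m H x).
Proof.
move=> dF dH HF.
have HFx := nbhs_singleton HF.
have : 'D_v (fun y => H y *m F y) x = 0.
  by rewrite -(derive_cst (1%:M : 'M[R]_n) x v); apply: near_eq_derive.
rewrite derive_mulmx // => /(congr1 (fun A => A *m H x)).
rewrite mul0mx mulmxDl -[_ *m F x *m _]mulmxA (mulmx1C HFx) mulmx1.
by move/eqP; rewrite addr_eq0 => /eqP.
Qed.

End InverseMatrix.

(** * Manifolds in charts *)

Section Charts.
Variables (R : realType) (d : nat) (M : manifold R d).
Implicit Types p q : M.

Definition in_chart p (x : 'rV[R]_d) : Prop :=
  (chart_coord (chart_at p) @` chart_dom (chart_at p)) x.

Lemma inv_coord p q : chart_dom (chart_at p) q -> inv_at p (coord_at p q) = q.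
Proof. exact: chart_invK. Qed.

Lemma inv_center p : inv_at p (center p) = p.
Proof. by apply: inv_coord; exact: chart_at_dom. Qed.

Lemma coord_inv p x : in_chart p x ->
  chart_dom (chart_at p) (inv_at p x) /\ coord_at p (inv_at p x) = x.
Proof. by move=> [q qp <-]; rewrite -/(coord_at p q) inv_coord. Qed.

Lemma in_chart_coord p q : chart_dom (chart_at p) q -> in_chart p (coord_at p q).
Proof. by move=> qp; exists q. Qed.

Lemma in_chart_center p : in_chart p (center p).
Proof. by apply: in_chart_coord; exact: chart_at_dom. Qed.

Lemma near_in_chart p x : in_chart p x -> \forall y \near x, in_chart p y.
Proof. by move=> px; apply: open_nbhs_nbhs; split => //; exact: chart_img_open. Qed.

Lemma near_chart_dom p q : chart_dom (chart_at p) q -> \forall y \near q, chart_dom (chart_at p) y.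
Proof. by move=> px; apply: open_nbhs_nbhs; split => //; exact: chart_dom_open. Qed.

Lemma chart_inv_continuous p x : in_chart p x -> {for x, continuous (inv_at p)}.
Proof. by move=> [q qp <-]; exact: chart_inv_cts. Qed.

Lemma transition_diff p q y :
  chart_dom (chart_at p) y -> chart_dom (chart_at q) y ->
  differentiable (coord_at q \o inv_at p) (coord_at p y).
Proof.
by move=> py qy; exact: C2_near_diff (smooth_C2 (chart_at_smooth py qy)).
Qed.

Lemma near_comp_dom (X : topologicalType) (c : X -> M) s p :
  {for s, continuous c} -> chart_dom (chart_at p) (c s) ->
  \forall y \near s, chart_dom (chart_at p) (c y).
Proof. by move=> cc ps; exact: (cc _ (near_chart_dom ps)). Qed.

Section ChainRule.
Variables (X W : normedModType R) (c : X -> M) (g : M -> W) (s : X) (q : M).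
Hypotheses (cs : c s = q) (c_cts : {for s, continuous c}).

(** Only local, since [inv_at q] undoes [coord_at q] only on the domain of the chart; continuity of
    c keeps its values there. The chain rules on manifolds rest on this factorization. *)
Lemma near_factor : {near s, (g \o inv_at q) \o (coord_at q \o c) =1 g \o c}.
Proof.
have qc : chart_dom (chart_at q) (c s) by rewrite cs; exact: chart_at_dom.
by apply: filterS (near_comp_dom c_cts qc) => y qy /=; rewrite inv_coord.
Qed.

Hypotheses (dc : differentiable (coord_at q \o c) s)
  (dg : differentiable (g \o inv_at q) (center q)).

Let dg' : differentiable (g \o inv_at q) ((coord_at q \o c) s).
Proof. by rewrite /= cs. Qed.

Lemma chain_diff : differentiable (g \o c) s.
Proof.
apply: near_eq_differentiable near_factor _; exact: differentiable_comp.
Qed.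

Lemma chain_derive v : 'D_v (g \o c) s = dfun g q ('D_v (coord_at q \o c) s).
Proof. by rewrite -(near_eq_derive _ near_factor) derive_comp //= cs. Qed.

End ChainRule.

Lemma chain_C2 (X : normedModType R) a b (c : X -> M) (g : M -> 'M[R]_(a, b)) s q :
  c s = q -> {for s, continuous c} -> C2_near (coord_at q \o c) s ->
  C2_near (g \o inv_at q) (center q) -> C2_near (g \o c) s.
Proof.
move=> cs cc c2 g2; apply: near_eq_C2 (near_factor g cs cc) _.
by apply: C2_comp => //=; rewrite cs.
Qed.

Lemma change_chart_id p v : change_chart p p (center p) v = v.
Proof.
rewrite /change_chart -[RHS](derive_id (center p)); apply: near_eq_derive.
by apply: filterS (near_in_chart (in_chart_center p)) => y /coord_inv[].
Qed.

Definition C2_fun a b (g : M -> 'M[R]_(a, b)) p : Prop :=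
  C2_near (g \o inv_at p) (center p).

Lemma near_eq_C2_fun a b (f1 f2 : M -> 'M[R]_(a, b)) p :
  {near p, f1 =1 f2} -> C2_fun f1 p -> C2_fun f2 p.
Proof.
move=> f12; apply: near_eq_C2.
have ic := chart_inv_continuous (in_chart_center p).
by have := ic (fun q => f1 q = f2 q); apply; rewrite inv_center.
Qed.

Section Local.
Variables (W : normedModType R) (g : M -> W) (p : M) (x : 'rV[R]_d).
Hypothesis px : in_chart p x.
Let q := inv_at p x.
Hypothesis dg : differentiable (g \o inv_at q) (center q).

Let dt : differentiable (coord_at q \o inv_at p) x.
Proof.
have [pq xe] := coord_inv px.
by have := transition_diff pq (chart_at_dom q); rewrite xe.
Qed.

Lemma local_diff : differentiable (g \o inv_at p) x.
Proof. exact: (chain_diff (q := q) erefl (chart_inv_continuous px) dt dg). Qed.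

(** [dfun] reads a function at the centre of the preferred chart of a point. This relates it to the
    derivative at an off-centre point of another chart, which is what [dform] requires. *)
Lemma local_derive w : 'D_w (g \o inv_at p) x = dfun g q (change_chart p q x w).
Proof. exact: (chain_derive (q := q) erefl (chart_inv_continuous px) dt dg). Qed.

End Local.
End Charts.

Section MapsC2.
Variable R : realType.

Definition C2_map d1 d2 (M1 : manifold R d1) (M2 : manifold R d2) (f : M1 -> M2) p : Prop :=
  {for p, continuous f} /\ C2_fun (coord_at (f p) \o f) p.

Lemma smooth_map_C2 d1 d2 (M1 : manifold R d1) (M2 : manifold R d2) (f : M1 -> M2) p :
  smooth_map_at f p -> C2_map f p.
Proof. by move=> [cf sf]; split => //; exact: smooth_C2. Qed.

Variables (d1 d2 d3 : nat).
Variables (M1 : manifold R d1) (M2 : manifold R d2) (M3 : manifold R d3).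

Lemma C2_map_inv_cts (f : M1 -> M2) p : {for p, continuous f} ->
  {for center p, continuous (f \o inv_at p)}.
Proof.
move=> fc; apply: continuous_comp; first exact/chart_inv_continuous/in_chart_center.
by rewrite inv_center.
Qed.

Lemma C2_fun_comp a b (f : M1 -> M2) (g : M2 -> 'M[R]_(a, b)) p :
  C2_map f p -> C2_fun g (f p) -> C2_fun (g \o f) p.
Proof.
move=> [cf f2] g2; apply: (chain_C2 (c := f \o inv_at p) (q := f p)) => //.
  by rewrite /= inv_center.
exact: C2_map_inv_cts.
Qed.

Lemma C2_map_comp (f : M1 -> M2) (g : M2 -> M3) p :
  C2_map f p -> C2_map g (f p) -> C2_map (g \o f) p.
Proof.
move=> f2 g2; split; last exact: C2_fun_comp f2 g2.2.
exact: continuous_comp f2.1 g2.1.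
Qed.

Lemma dfun_comp (W : normedModType R) (f : M1 -> M2) (g : M2 -> W) p v :
  C2_map f p -> differentiable (g \o inv_at (f p)) (center (f p)) ->
  dfun (g \o f) p v = dfun g (f p) (tangent_map f p v).
Proof.
move=> [cf f2] dg; rewrite /dfun.
rewrite -[_ \o inv_at p]/(g \o (f \o inv_at p)).
rewrite (chain_derive (q := f p)) //=.
- by rewrite inv_center.
- exact: C2_map_inv_cts.
- exact: C2_near_diff.
Qed.

Lemma tangent_map_comp (f : M1 -> M2) (g : M2 -> M3) p v :
  C2_map f p -> C2_map g (f p) ->
  tangent_map (g \o f) p v = tangent_map g (f p) (tangent_map f p v).
Proof.
move=> f2 g2; apply: (dfun_comp (g := coord_at (g (f p)) \o g)) => //.
exact: C2_near_diff g2.2.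
Qed.

Lemma dfun_linear (W : normedModType R) (g : M1 -> W) p :
  differentiable (g \o inv_at p) (center p) -> linear (dfun g p).
Proof. exact: derive_linear. Qed.

Lemma tangent_map_linear (f : M1 -> M2) p : C2_map f p -> linear (tangent_map f p).
Proof. by move=> [_ f2]; apply: derive_linear; exact: C2_near_diff. Qed.

Lemma tangent_local (f : M1 -> M2) p x w : in_chart p x -> C2_map f (inv_at p x) ->
  'D_w (coord_at (f (inv_at p x)) \o (f \o inv_at p)) x =
  tangent_map f (inv_at p x) (change_chart p (inv_at p x) x w).
Proof.
move=> px [cf f2].
exact: (local_derive (g := coord_at (f (inv_at p x)) \o f) px (C2_near_diff f2)).
Qed.

End MapsC2.

(** * The matrix exponential *)

Section MatrixExponential.
Variables (R : realType) (m : nat).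
Implicit Type X : 'M[R]_m.

Lemma cvg_mx_entries a b (u : nat -> 'M[R]_(a, b)) (L : 'M[R]_(a, b)) :
  (forall i j, (fun k => u k i j) @ \oo --> L i j) -> u @ \oo --> L.
Proof.
move=> uL; apply/cvgrPdist_le => /= e e0; near=> k.
rewrite [leLHS]/Num.Def.normr/= mx_normrE (bigmax_le _ (ltW e0))//= => -[i j] _.
rewrite !mxE /=.
move: i j; near: k; apply: filter_forall => i; apply: filter_forall => j.
have /cvgrPdist_le := uL i j; exact.
Unshelve. all: by end_near. Qed.

(** Domination by a multiple of the exponential series at |K| |x|. *)
Lemma cvg_pseries_fact (c : nat -> R) (A K x : R) :
  (forall k, `|c k| <= A * (K ^+ k / k`!%:R)) -> cvgn (pseries c x).
Proof.
move=> cb; apply: normed_cvg.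
have A0 : 0 <= A by have := cb 0; rewrite expr0 fact0 divr1 mulr1; exact: le_trans.
apply: (@series_le_cvg _ _ (A *: exp_coeff (`|K| * `|x|))) => //=.
- move=> k; rewrite -[_ k]/(A * exp_coeff (`|K| * `|x|) k) mulr_ge0 //.
  by apply: exp_coeff_ge0; rewrite mulr_ge0.
- move=> k; rewrite -[leRHS]/(A * ((`|K| * `|x|) ^+ k / k`!%:R)) normrM normrX exprMn.
  rewrite mulrAC mulrA ler_wpM2r ?exprn_ge0 //.
  apply: (le_trans (cb k)); rewrite ler_wpM2l // ler_wpM2r ?invr_ge0 //.
  by rewrite -normrX ler_norm.
- rewrite (_ : series _ = A *: series (exp_coeff (`|K| * `|x|))).
    by apply: is_cvgZr; exact: is_cvg_series_exp_coeff.
  by apply/funext => k; rewrite /series /= -[RHS]/(A * _) mulr_sumr.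
Qed.

Lemma limn_pseries0 (c : nat -> R) : limn (pseries c 0) = c 0.
Proof.
apply: lim_near_cst => //; exists 1 => // k /= k1.
rewrite /pseries /series /= big_mkord; case: k k1 => // k _.
rewrite big_ord_recl expr0 mulr1 big1 ?addr0 // => i _.
by rewrite expr0n /= mulr0.
Qed.

(** The norm is the largest absolute value of an entry, and an entry of a product is a sum of m
    products: hence the factor m. *)
Let K X : R := m%:R * `|X| + 1.

Lemma norm_mxpow X k i j : `|(X ^+ k) i j| <= K X ^+ k.
Proof.
have K1 : 1 <= K X by rewrite lerDr mulr_ge0.
elim: k i j => [|k IH] i j.
  by rewrite !expr0 mxE; case: eqP => _; rewrite ?normr1 ?normr0.
rewrite !exprS mxE; apply: (le_trans (ler_norm_sum _ _ _)).
apply: (@le_trans _ _ (\sum_(l < m) `|X| * K X ^+ k)).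
  apply: ler_sum => l _; rewrite normrM ler_pM //.
  rewrite [leRHS]/Num.Def.normr/= mx_normrE.
  exact: (le_bigmax _ (fun p => `|X p.1 p.2|) (i, l)).
rewrite sumr_const card_ord -mulr_natl mulrA ler_wpM2r ?exprn_ge0 ?lerDl //.
exact: le_trans K1.
Qed.

Let coefs X i j k : R := (X ^+ k) i j / k`!%:R.

Lemma exprZmx (s : R) X k : (s *: X) ^+ k = s ^+ k *: X ^+ k.
Proof.
elim: k => [|k IH]; first by rewrite !expr0 scale1r.
by rewrite !exprS IH -[LHS]/(_ *m _) -scalemxAl -scalemxAr scalerA.
Qed.

Lemma mexp_entry X (s : R) i j : mexp (s *: X) i j = limn (pseries (coefs X i j) s).
Proof.
have cv i' j' : cvgn (pseries (coefs X i' j') s).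
  apply: (@cvg_pseries_fact _ 1 (K X)) => k; rewrite mul1r normrM normfV normr_nat.
  by rewrite ler_wpM2r ?invr_ge0 // norm_mxpow.
suff L : series (fun k => (k`!%:R)^-1 *: (s *: X) ^+ k) @ \oo -->
    \matrix_(i, j) limn (pseries (coefs X i j) s).
  by rewrite /mexp (cvg_lim _ L) ?mxE //; exact: norm_hausdorff.
apply: cvg_mx_entries => i' j'; rewrite mxE.
rewrite (_ : (fun _ => _) = pseries (coefs X i' j') s); first exact: cv.
apply/funext => k; rewrite /pseries /series /= summxE; apply: eq_bigr => l _.
rewrite exprZmx !mxE /coefs; ring.
Qed.

Lemma mexp0 : mexp (0 : 'M[R]_m) = 1%:M.
Proof.
apply/matrixP => i j; rewrite -(scale0r 0) mexp_entry limn_pseries0 /coefs expr0.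
by rewrite fact0 divr1.
Qed.

Lemma is_derive_mexp X i j :
  is_derive (0 : R) 1 (fun s : R => mexp (s *: X) i j) (X i j).
Proof.
rewrite (_ : (fun _ => _) = fun s => limn (pseries (coefs X i j) s)); last first.
  by apply/funext => s; exact: mexp_entry.
(* Each formal differentiation in s replaces X^(k + l) / k! by X^(k + l + 1) / k!. Term-by-term
   differentiation at 0 asks that the series and its derived series converge at some point further
   out, here 1. *)
have D l : pseries_diffs (fun k => (X ^+ (k + l)) i j / k`!%:R) =
    (fun k => (X ^+ (k + l.+1)) i j / k`!%:R).
  apply/funext => k; rewrite /pseries_diffs addSnnS factS natrM invfM mulrCA.
  by rewrite mulVKf ?pnatr_eq0.
have CE : coefs X i j = (fun k => (X ^+ (k + 0)) i j / k`!%:R).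
  by apply/funext => k; rewrite addn0.
have cv l : cvgn (pseries (fun k => (X ^+ (k + l)) i j / k`!%:R) 1).
  apply: (@cvg_pseries_fact _ (K X ^+ l) (K X)) => k; rewrite normrM normfV normr_nat.
  by rewrite mulrA ler_wpM2r ?invr_ge0 // -exprD addnC norm_mxpow.
have -> : X i j = limn (pseries (pseries_diffs (coefs X i j)) 0).
  by rewrite CE D limn_pseries0 /= fact0 divr1 add0n expr1.
apply: (@pseries_snd_diffs _ _ 1); rewrite ?CE ?D ?normr0 ?normr1 //; exact: cv.
Qed.

End MatrixExponential.

(** * The gauge of a local section *)

Section Group.
Variables (R : realType) (r m : nat) (G : matrix_lie_group R r m).
Implicit Types h k : G.

Lemma matVr h : mat h *m mat (mlgV h) = 1%:M.
Proof. by apply: mulmx1C; exact: matV. Qed.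

Lemma mlgM_eq h k l : mlgM h k = l <-> k = mlgM (mlgV h) l.
Proof.
split=> [<-|->]; apply: (@mat_inj _ _ _ G); rewrite !matM mulmxA ?matV ?matVr mul1mx //.
Qed.

Lemma C2_fun_mat h : C2_fun (@mat _ _ _ G) h.
Proof. exact/smooth_C2/mat_smooth. Qed.

End Group.

Section Map2.
Variables (R : realType) (d1 d2 d3 : nat) (X : normedModType R).
Variables (M1 : manifold R d1) (M2 : manifold R d2) (M3 : manifold R d3).
Variables (f : M1 -> M2 -> M3) (c1 : X -> M1) (c2 : X -> M2) (s : X).
Hypotheses (cc1 : {for s, continuous c1}) (cc2 : {for s, continuous c2}).
Hypotheses (dc1 : differentiable (coord_at (c1 s) \o c1) s)
  (dc2 : differentiable (coord_at (c2 s) \o c2) s).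
Hypothesis sf : smooth_map2_at f (c1 s) (c2 s).

Lemma map2_cts : {for s, continuous (fun y => f (c1 y) (c2 y))}.
Proof.
case: sf => cf _.
exact: (@cvg_comp _ _ _ (fun y => (c1 y, c2 y)) (fun pq => f pq.1 pq.2)
  _ _ _ (cvg_pair cc1 cc2) cf).
Qed.

(** Smoothness in two variables is expressed on joined coordinates, so the two inner maps are first
    joined into one row vector. *)
Lemma map2_diff :
  differentiable (coord_at (f (c1 s) (c2 s)) \o (fun y => f (c1 y) (c2 y))) s.
Proof.
case: sf => _ /smooth_C2 /C2_near_diff.
set H := fun w : 'rV_ _ => _ => dH.
pose row y := row_mx ((coord_at (c1 s) \o c1) y) ((coord_at (c2 s) \o c2) y).
have drow : differentiable row s.
  apply: differentiable_mx => i j.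
  rewrite /row; case: (split_ordP j) => k ->.
    rewrite (_ : (fun _ => _) = fun y => (coord_at (c1 s) \o c1) y i k).
      exact: differentiable_entry.
    by apply/funext => y; rewrite row_mxEl.
  rewrite (_ : (fun _ => _) = fun y => (coord_at (c2 s) \o c2) y i k).
    exact: differentiable_entry.
  by apply/funext => y; rewrite row_mxEr.
apply: (near_eq_differentiable (f := H \o row)); last exact: differentiable_comp.
have n1 := near_comp_dom cc1 (chart_at_dom (c1 s)).
have n2 := near_comp_dom cc2 (chart_at_dom (c2 s)).
by apply: filterS2 n1 n2 => y y1 y2; rewrite /H /= row_mxKl row_mxKr !inv_coord.
Qed.

End Map2.

Section Gauge.
Variables (R : realType) (n r m : nat) (M : manifold R n) (g : metric M).
Variables (G : matrix_lie_group R r m) (t : lie_basis G).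
Variables (P : manifold R (n + r)) (B : principal_bundle M G P).
Variable F : local_frame g B.
Implicit Types z : P.

(* In a trivialization tau, the equation sigma(proj z) . h = z reads
   tau(sigma(proj z)) h = tau(z). *)
Lemma local_gauge x : exists U : set M, exists tau : P -> G,
  [/\ open U, U x, (forall z, U (proj B z) -> smooth_map_at tau z) &
   forall z h, U (proj B z) -> lf_dom F (proj B z) ->
    act B (lf_sigma F (proj B z)) h = z <->
    h = mlgM (mlgV (tau (lf_sigma F (proj B z)))) (tau z)].
Proof.
have [U [tau [psi [oU Ux stau spsi [tact ppsi tpsi psiK]]]]] := local_triviality B x.
exists U, tau; split => // z h Uz dz.
have Us : U (proj B (lf_sigma F (proj B z))) by rewrite lf_sigma_section.
rewrite -mlgM_eq -tact //; split=> [-> //|E].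
have := psiK (act B (lf_sigma F (proj B z)) h).
by rewrite proj_act lf_sigma_section // E psiK // => /(_ Uz).
Qed.

(** In a trivialization the equation for h has exactly one solution, so the choice made by [xget] is
    forced. *)
Lemma gauge_eq z h : lf_dom F (proj B z) ->
  act B (lf_sigma F (proj B z)) h = z -> gauge F z = h.
Proof.
move=> dz; have [U [tau [_ Uz _ act_iff]]] := local_gauge (proj B z).
move=> /(act_iff _ _ Uz dz) ->; rewrite /gauge; case: xgetP => [k _|] /=.
  by move/(act_iff _ _ Uz dz).
move=> /(_ (mlgM (mlgV (tau (lf_sigma F (proj B z)))) (tau z))) /=.
by move/(act_iff _ _ Uz dz).
Qed.

Lemma gaugeP z : lf_dom F (proj B z) -> act B (lf_sigma F (proj B z)) (gauge F z) = z.
Proof.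
move=> dz; have [U [tau [_ Uz _ act_iff]]] := local_gauge (proj B z).
have E := (act_iff _ _ Uz dz).2 erefl.
by rewrite (gauge_eq dz E).
Qed.

Lemma gauge_act z h : lf_dom F (proj B z) ->
  gauge F (act B z h) = mlgM (gauge F z) h.
Proof.
move=> dz; apply: gauge_eq; first by rewrite proj_act.
by rewrite proj_act actM gaugeP.
Qed.

Lemma gauge_sigma x h : lf_dom F x -> gauge F (act B (lf_sigma F x) h) = h.
Proof.
move=> dx; apply: gauge_eq; rewrite proj_act lf_sigma_section //.
Qed.

Lemma C2_map_proj z : C2_map (proj B) z.
Proof. exact/smooth_map_C2/proj_smooth. Qed.

Lemma near_frame_dom z : lf_dom F (proj B z) -> \forall z' \near z, lf_dom F (proj B z').
Proof.
move=> dz; apply: (C2_map_proj z).1.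
by apply: open_nbhs_nbhs; split => //; exact: lf_dom_open.
Qed.

(** Near z the chosen h equals tau(sigma(proj z))^-1 tau(z), a composite of smooth maps; its inverse
    is tau(z)^-1 tau(sigma(proj z)). *)
Lemma C2_fun_gauge z : lf_dom F (proj B z) ->
  C2_fun (fun z => mat (gauge F z)) z /\ C2_fun (fun z => mat (mlgV (gauge F z))) z.
Proof.
move=> dz; have [U [tau [oU Uz stau act_iff]]] := local_gauge (proj B z).
pose sig := tau \o (lf_sigma F \o proj B).
have Un : \forall z' \near z, U (proj B z').
  by apply: (C2_map_proj z).1; apply: open_nbhs_nbhs.
have gE : \forall z' \near z, mlgM (mlgV (sig z')) (tau z') = gauge F z'.
  apply: filterS2 Un (near_frame_dom dz) => z' Uz' dz'.
  by apply/esym/act_iff => //; exact: gaugeP.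
have ctau z' : U (proj B z') -> C2_map tau z' by move=> /stau/smooth_map_C2.
have csig : C2_map sig z.
  apply: C2_map_comp; last by apply: ctau; rewrite /= lf_sigma_section.
  apply: C2_map_comp; first exact: C2_map_proj.
  exact/smooth_map_C2/lf_sigma_smooth.
have cV f : C2_map f z -> C2_fun (@mat _ _ _ G \o (@mlgV _ _ _ G \o f)) z.
  move=> cf; apply: C2_fun_comp (C2_fun_mat _).
  by apply: C2_map_comp => //; exact/smooth_map_C2/mlgV_smooth.
split.
  apply: (near_eq_C2_fun (f1 := fun z => mat (mlgV (sig z)) *m mat (tau z))).
    by apply: filterS gE => z' <-; rewrite matM.
  apply: C2_mulmx; first exact: cV.
  exact: (C2_fun_comp (ctau _ Uz) (C2_fun_mat _)).
apply: (near_eq_C2_fun (f1 := fun z => mat (mlgV (tau z)) *m mat (sig z))).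
  apply: filterS gE => z' <-; set h := mlgM _ _.
  rewrite -[LHS]mulmx1 -(matVr h) mulmxA -[RHS]mul1mx; congr (_ *m _).
  rewrite /h matM mulmxA -[_ *m mat (sig z') *m _]mulmxA matVr mulmx1 matV //.
apply: C2_mulmx; first exact/cV/ctau.
exact: (C2_fun_comp csig (C2_fun_mat _)).
Qed.

End Gauge.

(** * The frame on the principal bundle *)

Section Fundamental.
Variables (R : realType) (n r m : nat) (M : manifold R n).
Variables (G : matrix_lie_group R r m) (P : manifold R (n + r)).
Variable B : principal_bundle M G P.

(** [lie_exp] is a pointwise choice. As [mat] is injective, it agrees with the smooth one-parameter
    subgroup given by membership in the Lie algebra, which can be differentiated. *)
Lemma lie_exp_curve xi : in_lie_algebra G xi -> exists c : R -> G,
  [/\ forall s, smooth_curve_at c s, c 0 = mlg1 G,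
      forall s, mat (c s) = mexp (s *: xi) &
      forall z, fundamental B xi z = velocity (fun s => act B z (c s)) 0].
Proof.
move=> [c cP]; exists c; have cm s : mat (c s) = mexp (s *: xi) by case: (cP s).
split=> // [s||z].
- by case: (cP s).
- by apply: (@mat_inj _ _ _ G); rewrite cm scale0r mexp0 mat1.
- rewrite /fundamental; congr (velocity _ 0); apply/funext => s; congr act.
  rewrite /lie_exp; case: xgetP => [h _ /= hE|/(_ (c s))]; last by rewrite /= cm.
  by apply: (@mat_inj _ _ _ G); rewrite hE cm.
Qed.

Lemma dfun_fundamental (W : normedModType R) (f : P -> W) xi z c :
  (forall s, smooth_curve_at c s) -> c 0 = mlg1 G ->
  fundamental B xi z = velocity (fun s => act B z (c s)) 0 ->
  differentiable (f \o inv_at z) (center z) ->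
  dfun f z (fundamental B xi z) = 'D_1 (fun s : R => f (act B z (c s))) 0.
Proof.
move=> sc c0 -> df.
have z0 : act B z (c 0) = z by rewrite c0 act1.
have [cc /smooth_C2/C2_near_diff dc] := sc 0.
have cz : {for (0 : R), continuous (fun _ : R => z)} by exact: cst_continuous.
have dz : differentiable (coord_at z \o (fun _ : R => z)) 0.
  exact: (differentiable_cst (coord_at z z)).
have sa := act_smooth B z (c 0).
have ca := map2_cts cz cc sa.
have da := map2_diff cz cc dz dc sa.
rewrite z0 in da.
have := chain_derive (c := fun s => act B z (c s)) (g := f) z0 ca da df 1.
by rewrite /velocity z0 => ->.
Qed.

End Fundamental.

(** Pairing with e_b reads off the b-th coefficient up to sign. This gives the freeness of the frame
    and a formula for beta^b. *)
Lemma inner_sum_e (R : realType) (n r m : nat) (M : manifold R n) (g : metric M)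
    (G : matrix_lie_group R r m) (P : manifold R (n + r)) (B : principal_bundle M G P)
    (F : local_frame g B) x (dx : lf_dom F x) b (k : 'I_n -> R) :
  inner g x (lf_e F b x) (\sum_a k a *: lf_e F a x) = (-1) ^+ lf_sign F b * k b.
Proof.
rewrite /inner linear_sum mulmx_sumr summxE (bigD1 b) //= big1 ?addr0 => [|a ab].
  rewrite linearZ /= -scalemxAr mxE mulrC; congr (_ * _).
  by rewrite -[LHS]/(inner g x _ _) lf_orthonormal // eqxx.
rewrite linearZ /= -scalemxAr mxE -[X in _ * X]/(inner g x _ _) lf_orthonormal //.
by rewrite eq_sym (negPf ab) mulr0.
Qed.

Section Frame.
Variables (R : realType) (n r m : nat) (M : manifold R n) (g : metric M).
Variables (G : matrix_lie_group R r m) (t : lie_basis G).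
Variables (P : manifold R (n + r)) (B : principal_bundle M G P).
Variable F : local_frame g B.
Variable z : P.
Hypothesis dz : lf_dom F (proj B z).

Let x := proj B z.

Lemma basis_in_lie_algebra j : in_lie_algebra G (tnth t j).
Proof. by apply/lb_span; apply: memv_span; exact: mem_tnth. Qed.

(** e_a(z) is tangent to x |-> sigma(x) . h with h frozen at the gauge of z. Along this map the base
    point is x and the gauge stays h, whence [proj_frame_e] and [gauge_frame_e]. *)
Lemma dfun_frame_e (W : normedModType R) (f : P -> W) a :
  differentiable (f \o inv_at z) (center z) ->
  dfun f z (frame_e F a z) =
  'D_(lf_e F a x) (fun y => f (act B (lf_sigma F (inv_at x y)) (gauge F z))) (center x).
Proof.
move=> df; set h := gauge F z; set s := center x.
pose c := fun y : 'rV[R]_n => act B (lf_sigma F (inv_at x y)) h.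
have cs : c s = z by rewrite /c inv_center; exact: gaugeP.
have [csig dsig] := smooth_map_C2 (lf_sigma_smooth dz).
have cc1 : {for s, continuous (lf_sigma F \o inv_at x)}.
  exact: C2_map_inv_cts.
have cc2 : {for s, continuous (fun _ : 'rV[R]_n => h)} by exact: cst_continuous.
have dc1 : differentiable (coord_at ((lf_sigma F \o inv_at x) s) \o (lf_sigma F \o inv_at x)) s.
  by rewrite /= inv_center; exact: C2_near_diff dsig.
have dc2 : differentiable (coord_at h \o (fun _ : 'rV[R]_n => h)) s.
  exact: (differentiable_cst (coord_at h h)).
have sa := act_smooth B ((lf_sigma F \o inv_at x) s) h.
have ca := map2_cts cc1 cc2 sa.
have da := map2_diff cc1 cc2 dc1 dc2 sa.
have da' : differentiable (coord_at z \o c) s by have := da; rewrite -[act B _ _]/(c s) cs.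
rewrite -[RHS]/('D_(lf_e F a x) (f \o c) s) (chain_derive (q := z) cs ca da' df).
congr dfun; rewrite /frame_e /tangent_map.
by rewrite (gaugeP dz).
Qed.

Let dproj : differentiable ((coord_at x \o proj B) \o inv_at z) (center z).
Proof. exact: C2_near_diff (C2_map_proj B z).2. Qed.

Let dgauge : differentiable ((fun z => mat (gauge F z)) \o inv_at z) (center z).
Proof. exact: C2_near_diff (C2_fun_gauge dz).1. Qed.

Lemma proj_frame_e a : tangent_map (proj B) z (frame_e F a z) = lf_e F a x.
Proof.
rewrite -[LHS]/(dfun (coord_at x \o proj B) z _) dfun_frame_e //.
rewrite -[RHS](derive_id (center x)); apply: near_eq_derive.
have ic := chart_inv_continuous (in_chart_center x).
have nd : \forall y \near center x, lf_dom F (inv_at x y).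
  apply: ic; rewrite inv_center; apply: open_nbhs_nbhs.
  by split => //; exact: lf_dom_open.
apply: filterS2 nd (near_in_chart (in_chart_center x)) => y dy /coord_inv[_ yE] /=.
by rewrite proj_act lf_sigma_section.
Qed.

Lemma proj_fundamental xi : in_lie_algebra G xi ->
  tangent_map (proj B) z (fundamental B xi z) = 0.
Proof.
move=> /(lie_exp_curve B) [c [sc c0 cm cE]].
rewrite -[LHS]/(dfun (coord_at x \o proj B) z _) (dfun_fundamental sc c0 (cE z)) //.
rewrite (_ : (fun s : R => _) = cst (coord_at x x)) ?derive_cst //.
by apply/funext => s /=; rewrite proj_act.
Qed.

Lemma gauge_frame_e a : dfun (fun z => mat (gauge F z)) z (frame_e F a z) = 0.
Proof.
rewrite dfun_frame_e // -(derive_cst (mat (gauge F z)) (center x) (lf_e F a x)).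
apply: near_eq_derive.
have ic := chart_inv_continuous (in_chart_center x).
have nd : \forall y \near center x, lf_dom F (inv_at x y).
  apply: ic; rewrite inv_center; apply: open_nbhs_nbhs.
  by split => //; exact: lf_dom_open.
by apply: filterS nd => y dy; rewrite gauge_sigma.
Qed.

Lemma gauge_fundamental xi : in_lie_algebra G xi ->
  dfun (fun z => mat (gauge F z)) z (fundamental B xi z) = mat (gauge F z) *m xi.
Proof.
move=> /(lie_exp_curve B) [c [sc c0 cm cE]].
rewrite (dfun_fundamental sc c0 (cE z)) //.
have dm i j : derivable (fun s : R => mexp (s *: xi) i j) 0 1.
  by have := is_derive_mexp xi i j => - [].
have dm' : differentiable (fun s : R => mexp (s *: xi)) 0.
  by apply: differentiable_mx => i j; apply/derivable1_diffP; exact: dm.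
rewrite (_ : (fun s : R => _) = fun s => (cst (mat (gauge F z)) s) *m mexp (s *: xi)); last first.
  by apply/funext => s; rewrite gauge_act // matM cm.
rewrite derive_mulmx // derive_cst mul0mx add0r; congr (_ *m _).
apply/matrixP => i j; rewrite derive_entry //.
by have := is_derive_mexp xi i j => - [].
Qed.

Lemma frame_coords (w : 'rV[R]_(n + r)) : w *m frame_mx t F z =
  \sum_a w 0 (lshift r a) *: frame_e F a z + \sum_j w 0 (rshift n j) *: frame_rho t B j z.
Proof.
rewrite -{1}[w]hsubmxK mul_row_col !mulmx_sum_row.
by congr (_ + _); apply: eq_bigr => k _; rewrite rowK mxE.
Qed.

Lemma proj_frame_rho j : tangent_map (proj B) z (frame_rho t B j z) = 0.
Proof. exact/proj_fundamental/basis_in_lie_algebra. Qed.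

(* h^-1 dh for z = sigma(x) . h *)
Definition maurer_cartan (v : 'rV[R]_(n + r)) : 'M[R]_m :=
  mat (mlgV (gauge F z)) *m dfun (fun z => mat (gauge F z)) z v.

Lemma tproj_linear : linear (tangent_map (proj B) z).
Proof. exact/tangent_map_linear/C2_map_proj. Qed.

Lemma maurer_cartan_linear : linear maurer_cartan.
Proof.
move=> c u v; rewrite /maurer_cartan (dfun_linear dgauge) mulmxDr.
by rewrite -scalemxAr.
Qed.

Lemma maurer_cartan_e a : maurer_cartan (frame_e F a z) = 0.
Proof. by rewrite /maurer_cartan gauge_frame_e mulmx0. Qed.

Lemma maurer_cartan_rho j : maurer_cartan (frame_rho t B j z) = tnth t j.
Proof.
rewrite /maurer_cartan gauge_fundamental; last exact: basis_in_lie_algebra.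
by rewrite mulmxA matV mul1mx.
Qed.

Let Tlin := GRing.isLinear.Build _ _ _ _ (tangent_map (proj B) z) tproj_linear.
Let T : {linear 'rV[R]_(n + r) -> 'rV[R]_n} := HB.pack (tangent_map (proj B) z) Tlin.
Let MClin := GRing.isLinear.Build _ _ _ _ maurer_cartan maurer_cartan_linear.
Let MC : {linear 'rV[R]_(n + r) -> 'M[R]_m} := HB.pack maurer_cartan MClin.

Lemma proj_coords (w : 'rV[R]_(n + r)) :
  tangent_map (proj B) z (w *m frame_mx t F z) = \sum_a w 0 (lshift r a) *: lf_e F a x.
Proof.
rewrite frame_coords -[LHS]/(T _) linearD !linear_sum /=.
rewrite [X in _ + X]big1 ?addr0 => [|j _].
  by apply: eq_bigr => a _; rewrite -[LHS]/(T _) linearZ /= proj_frame_e.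
by rewrite -[LHS]/(T _) linearZ /= proj_frame_rho scaler0.
Qed.

Lemma maurer_cartan_coords (w : 'rV[R]_(n + r)) :
  maurer_cartan (w *m frame_mx t F z) = \sum_j w 0 (rshift n j) *: tnth t j.
Proof.
rewrite frame_coords -[LHS]/(MC _) linearD !linear_sum /=.
rewrite [X in X + _]big1 ?add0r => [|j _].
  by apply: eq_bigr => a _; rewrite -[LHS]/(MC _) linearZ /= maurer_cartan_rho.
by rewrite -[LHS]/(MC _) linearZ /= maurer_cartan_e scaler0.
Qed.

Lemma tnth_lie_basis j : tnth t j = (t : seq _)`_j.
Proof. exact: tnth_nth. Qed.

Lemma coord_sum_basis (k : 'I_r -> R) i : coord t i (\sum_j k j *: tnth t j) = k i.
Proof.
under eq_bigr do rewrite tnth_lie_basis.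
by rewrite coord_sum_free //; exact: lb_free.
Qed.

(** Suppose a combination of the frame vanishes. The differential of [proj] sees only its e_a part,
    which is zero by orthonormality; h^-1 dh sees only its rho_j part, which is zero because the t_j
    are free. Only now does [invmx] yield a dual coframe. *)
Lemma frame_mx_unit : frame_mx t F z \in unitmx.
Proof.
rewrite -row_free_unit -kermx_eq0; apply/eqP/row_matrixP => i; rewrite row0.
set w := row i _.
have w0 : w *m frame_mx t F z = 0 by rewrite /w -row_mul mulmx_ker row0.
have T0 : tangent_map (proj B) z 0 = 0 by exact: (linear0 T).
have M0 : maurer_cartan 0 = 0 by exact: (linear0 MC).
have we : \sum_a w 0 (lshift r a) *: lf_e F a x = 0 by rewrite -proj_coords w0.
have wr : \sum_j w 0 (rshift n j) *: tnth t j = 0 by rewrite -maurer_cartan_coords w0.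
apply/rowP => k; rewrite [RHS]mxE; case: (split_ordP k) => j ->.
  have := inner_sum_e dz j (fun a => w 0 (lshift r a)); rewrite we /inner trmx0 mulmx0 mxE.
  by move/esym/eqP; rewrite mulf_eq0 signr_eq0 => /eqP.
by rewrite -(coord_sum_basis (fun j => w 0 (rshift n j)) j) wr linear0.
Qed.

Let cof v : 'rV[R]_(n + r) := v *m invmx (frame_mx t F z).

Let cofK v : cof v *m frame_mx t F z = v.
Proof. by rewrite /cof mulmxKV // frame_mx_unit. Qed.

Lemma frame_decomp v : v = \sum_a coframe_beta t F a z v *: frame_e F a z
  + \sum_j coframe_gamma t F j z v *: frame_rho t B j z.
Proof. by rewrite -[LHS]cofK frame_coords. Qed.

Lemma proj_beta v :
  tangent_map (proj B) z v = \sum_a coframe_beta t F a z v *: lf_e F a x.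
Proof. by rewrite -{1}[v]cofK proj_coords. Qed.

(** Shows that beta^a is pulled back from M, as it depends on v only through the projection of v. *)
Lemma coframe_beta_inner a v : coframe_beta t F a z v =
  (-1) ^+ lf_sign F a * inner g x (lf_e F a x) (tangent_map (proj B) z v).
Proof. by rewrite proj_beta inner_sum_e // mulrA -expr2 sqrr_sign mul1r. Qed.

Lemma maurer_cartan_gamma v :
  maurer_cartan v = \sum_j coframe_gamma t F j z v *: tnth t j.
Proof. by rewrite -{1}[v]cofK maurer_cartan_coords. Qed.

Lemma coframe_beta_e a b : coframe_beta t F a z (frame_e F b z) = (a == b)%:R.
Proof.
rewrite coframe_beta_inner proj_frame_e lf_orthonormal //.
by case: eqP => [->|_]; rewrite ?mulr0 // -expr2 sqrr_sign.
Qed.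

Lemma coframe_gamma_rho i j : coframe_gamma t F i z (frame_rho t B j z) = (i == j)%:R.
Proof.
have := coord_sum_basis (fun k => coframe_gamma t F k z (frame_rho t B j z)) i.
rewrite -maurer_cartan_gamma maurer_cartan_rho tnth_lie_basis coord_free ?lb_free //.
by move=> <-; rewrite eq_sym.
Qed.

Variable eta : 'rV[R]_(n + r) -> 'M[R]_m.
Hypothesis neta : normalized_form B z eta.

(** eta is determined by its values on the frame: normalization imposes t_j on rho_j, and the value
    on e_a lies in the span of the basis. *)
Lemma normalized_form_decomp v : eta v =
  \sum_a coframe_beta t F a z v *: \sum_i coord t i (eta (frame_e F a z)) *: tnth t i
  + \sum_i coframe_gamma t F i z v *: tnth t i.
Proof.
case: neta => lin_eta lie_eta fund_eta.
pose el := GRing.isLinear.Build _ _ _ _ eta lin_eta.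
pose eL : {linear 'rV[R]_(n + r) -> 'M[R]_m} := HB.pack eta el.
rewrite {1}[v]frame_decomp -[LHS]/(eL _) linearD !linear_sum /=.
congr (_ + _); apply: eq_bigr => a _; rewrite -[LHS]/(eL _) linearZ /=; congr (_ *: _).
  have /lb_span := lie_eta (frame_e F a z); move/(_ t) => /coord_span {1}->.
  by apply: eq_bigr => i _; rewrite tnth_lie_basis.
by rewrite fund_eta //; exact: basis_in_lie_algebra.
Qed.

End Frame.

(** * The dual coframe on the base *)

Section BaseCoframe.
Variables (R : realType) (n r m : nat) (M : manifold R n) (g : metric M).
Variables (G : matrix_lie_group R r m).
Variables (P : manifold R (n + r)) (B : principal_bundle M G P).
Variable F : local_frame g B.
Variable x : M.
Hypothesis dx : lf_dom F x.

Definition local_frame_mx (y : 'rV[R]_n) : 'M[R]_n :=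
  \matrix_a vfield_in_chart (lf_e F a) x y.

Lemma local_frame_mx_center a : row a (local_frame_mx (center x)) = lf_e F a x.
Proof. by rewrite rowK /vfield_in_chart inv_center change_chart_id. Qed.

Lemma local_frame_mx_diff : differentiable local_frame_mx (center x).
Proof.
apply: differentiable_mx => a k.
rewrite (_ : (fun _ => _) = fun y => vfield_in_chart (lf_e F a) x y 0 k).
  apply: differentiable_entry; apply: C2_near_diff; apply: smooth_C2.
  exact: lf_e_smooth.
by apply/funext => y; rewrite mxE.
Qed.

Lemma derive_local_frame_mx a v : row a ('D_v local_frame_mx (center x)) =
  'D_v (vfield_in_chart (lf_e F a) x) (center x).
Proof.
have dE := local_frame_mx_diff.
apply/rowP => k; rewrite mxE (derive_entry _ _ _ dE).
have dv : differentiable (vfield_in_chart (lf_e F a) x) (center x).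
  by apply/C2_near_diff/smooth_C2/lf_e_smooth.
rewrite (derive_entry _ _ _ dv).
have -> : (fun y => local_frame_mx y a k) = (fun y => vfield_in_chart (lf_e F a) x y 0 k).
  by apply/funext => y; rewrite mxE.
by [].
Qed.

Lemma local_frame_mx_unit : local_frame_mx (center x) \in unitmx.
Proof.
set E := local_frame_mx _.
rewrite -row_free_unit -kermx_eq0; apply/eqP/row_matrixP => i; rewrite row0.
set w := row i _.
have w0 : w *m E = 0 by rewrite /w -row_mul mulmx_ker row0.
apply/rowP => b; rewrite [RHS]mxE.
have := inner_sum_e dx b (fun a => w 0 a).
have -> : \sum_a w 0 a *: lf_e F a x = 0.
  transitivity (w *m E) => //; rewrite mulmx_sum_row; apply: eq_bigr => a _.
  by rewrite local_frame_mx_center.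
rewrite /inner trmx0 mulmx0 mxE.
by move/esym/eqP; rewrite mulf_eq0 signr_eq0 => /eqP.
Qed.

(** Tangent vectors are rows, so column a is the 1-form dual to e_a, and [u *m local_coframe_mx y]
    lists the frame components of u. *)
Definition local_coframe_mx y := invmx (local_frame_mx y).

Lemma near_local_frameK : \forall y \near center x,
  local_frame_mx y *m local_coframe_mx y = 1%:M.
Proof.
have := near_unitmx local_frame_mx_diff local_frame_mx_unit.
by apply: filterS => y; exact: mulmxV.
Qed.

Lemma local_coframe_mx_diff : differentiable local_coframe_mx (center x).
Proof. exact: differentiable_invmx local_frame_mx_diff local_frame_mx_unit. Qed.

Lemma derive_local_coframe_mx v : 'D_v local_coframe_mx (center x) =
  - (local_coframe_mx (center x) *m 'D_v local_frame_mx (center x)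
     *m local_coframe_mx (center x)).
Proof.
apply: derive_left_inverse; [exact: local_frame_mx_diff|exact: local_coframe_mx_diff|].
have := near_unitmx local_frame_mx_diff local_frame_mx_unit.
by apply: filterS => y; exact: mulVmx.
Qed.

Variables (nabla : vfield M -> M -> 'rV[R]_n -> 'rV[R]_n).
Hypothesis nabla_lc : levi_civita g nabla.
Variable omega : 'I_n -> 'I_n -> M -> 'rV[R]_n -> R.
Hypothesis omega_conn : connection_forms F nabla omega.

(* [e_b, e_c] = structure_coef a b c e_a *)
Definition structure_coef (a b c : 'I_n) : R :=
  omega a c x (lf_e F b x) - omega a b x (lf_e F c x).

Lemma bracket_frame b c : lie_bracket (lf_e F b) (lf_e F c) x =
  \sum_a structure_coef a b c *: lf_e F a x.
Proof.
rewrite -(lc_torsion_free nabla_lc); try exact: lf_e_smooth.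
rewrite !omega_conn // -sumrB; apply: eq_bigr => a _.
by rewrite scalerBl.
Qed.

(** With T = E^-1 one has dT = - T dE T. Expanding u and v in the frame, the antisymmetrized
    derivatives of the rows of E are the brackets [e_b, e_c], which torsion-freeness expresses
    through omega. *)
Lemma d_local_coframe u v a :
  let th w := w *m local_coframe_mx (center x) in
  (v *m 'D_u local_coframe_mx (center x) - u *m 'D_v local_coframe_mx (center x)) 0 a =
  - \sum_b \sum_c structure_coef a b c * (th u 0 b * th v 0 c).
Proof.
move=> th; set E := local_frame_mx; set T := local_coframe_mx (center x).
have ET : E (center x) *m T = 1%:M by exact: mulmxV local_frame_mx_unit.
have TE : T *m E (center x) = 1%:M by exact: mulmx1C.
have dEl : linear (fun w => 'D_w E (center x)).
  by apply: derive_linear; exact: local_frame_mx_diff.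
pose dl := GRing.isLinear.Build _ _ _ _ (fun w => 'D_w E (center x)) dEl.
pose D : {linear 'rV[R]_n -> 'M[R]_n} := HB.pack (fun w => 'D_w E (center x)) dl.
have DE w w' : th w *m 'D_w' E (center x) =
    \sum_c \sum_b (th w 0 c * th w' 0 b) *:
      'D_(lf_e F b x) (vfield_in_chart (lf_e F c) x) (center x).
  rewrite mulmx_sum_row; apply: eq_bigr => c _.
  have {1}-> : w' = \sum_b th w' 0 b *: lf_e F b x.
    rewrite -[LHS]mulmx1 -TE mulmxA mulmx_sum_row; apply: eq_bigr => b _.
    by rewrite local_frame_mx_center.
  rewrite -[X in row c X]/(D _) !linear_sum /=; apply: eq_bigr => b _.
  by rewrite -[X in row c X]/(D _) !linearZ /= -derive_local_frame_mx scalerA mulrC.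
rewrite !derive_local_coframe_mx !mulmxN opprK addrC !mulmxA -/T.
rewrite -/(th u) -/(th v) -mulmxBl !DE.
rewrite [X in _ - X]exchange_big /= -sumrB.
transitivity ((- (\sum_b \sum_c (th u 0 b * th v 0 c) *:
   lie_bracket (lf_e F b) (lf_e F c) x) *m T) 0 a).
  congr ((_ *m T) 0 a); rewrite -sumrN; apply: eq_bigr => b _.
  rewrite -sumrB -sumrN; apply: eq_bigr => c _.
  rewrite /lie_bracket scalerBr opprB [th v 0 c * _]mulrC //.
rewrite mulNmx mxE; congr (- _).
rewrite mulmx_suml summxE; apply: eq_bigr => b _.
rewrite mulmx_suml summxE; apply: eq_bigr => c _.
rewrite -scalemxAl mxE mulrC; congr (_ * _).
rewrite bracket_frame mulmx_suml summxE (bigD1 a) //= big1 ?addr0 => [|a' a'a];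
  rewrite -scalemxAl -local_frame_mx_center -row_mul ET !mxE.
  by rewrite eqxx mulr1.
by rewrite (negPf a'a) mulr0.
Qed.

End BaseCoframe.

(** * The differential of the canonical form *)

Section StructureEquations.
Variables (R : realType) (n r m : nat) (M : manifold R n) (g : metric M).
Variables (nabla : vfield M -> M -> 'rV[R]_n -> 'rV[R]_n).
Hypothesis nabla_lc : levi_civita g nabla.
Variables (G : matrix_lie_group R r m) (t : lie_basis G).
Variables (P : manifold R (n + r)) (B : principal_bundle M G P).
Variable F : local_frame g B.
Variable omega : 'I_n -> 'I_n -> M -> 'rV[R]_n -> R.
Hypothesis omega_conn : connection_forms F nabla omega.
Variables (E : normalized_bundle t F) (N : multimomentum_manifold E).
Implicit Type nu : N.

Lemma N_proj_dom nu : lf_dom F (proj B (N_proj nu)).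
Proof. exact: mm_dom. Qed.

Lemma C2_map_mm nu : C2_map (fun nu : N => mm_proj nu) nu.
Proof. exact/smooth_map_C2/mm_proj_smooth. Qed.

Lemma C2_map_N_proj nu : C2_map (fun nu : N => N_proj nu) nu.
Proof.
apply: (C2_map_comp (C2_map_mm nu)); exact/smooth_map_C2/nb_proj_smooth.
Qed.

Lemma C2_map_base nu : C2_map (fun nu : N => proj B (N_proj nu)) nu.
Proof. exact: (C2_map_comp (C2_map_N_proj nu) (C2_map_proj B _)). Qed.

Lemma C2_gauge_N nu : C2_fun (fun nu : N => mat (gauge F (N_proj nu))) nu.
Proof.
exact: (C2_fun_comp (C2_map_N_proj nu) (C2_fun_gauge (N_proj_dom nu)).1).
Qed.

Lemma C2_gaugeV_N nu : C2_fun (fun nu : N => mat (mlgV (gauge F (N_proj nu)))) nu.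
Proof.
exact: (C2_fun_comp (C2_map_N_proj nu) (C2_fun_gauge (N_proj_dom nu)).2).
Qed.

Lemma nb_coef_diff i a (y : E) : lf_dom F (proj B (nb_proj y)) ->
  differentiable (@nb_coef _ _ _ _ _ _ _ _ _ _ _ E i a \o inv_at y) (center y).
Proof. by move=> dy; exact: (nbhs_singleton (nb_coef_smooth i a dy) [::]). Qed.

Lemma eta_coef_diff i a nu :
  differentiable ((fun nu : N => eta_coef i a nu) \o inv_at nu) (center nu).
Proof.
have [cm c2] := C2_map_mm nu.
apply: (chain_diff (c := (fun nu : N => mm_proj nu) \o inv_at nu)
  (g := @nb_coef _ _ _ _ _ _ _ _ _ _ _ E i a) (q := mm_proj nu)).
- by rewrite /= inv_center.
- exact: C2_map_inv_cts.
- exact: C2_near_diff c2.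
- exact/nb_coef_diff/mm_dom.
Qed.

Lemma dfun_eta_coef i a nu v : dfun (fun nu : N => eta_coef i a nu) nu v =
  dfun (@nb_coef _ _ _ _ _ _ _ _ _ _ _ E i a) (mm_proj nu)
    (tangent_map (fun nu : N => mm_proj nu) nu v).
Proof. exact: (dfun_comp v (C2_map_mm nu) (nb_coef_diff i a (mm_dom nu))). Qed.

Lemma dfun_gauge_N nu v : dfun (fun nu : N => mat (gauge F (N_proj nu))) nu v =
  dfun (fun z => mat (gauge F z)) (N_proj nu) (tangent_map (fun nu : N => N_proj nu) nu v).
Proof.
apply: (dfun_comp (g := fun z => mat (gauge F z)) v (C2_map_N_proj nu)).
exact/C2_near_diff/(C2_fun_gauge (N_proj_dom _)).1.
Qed.

Definition beta_N a nu v :=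
  coframe_beta t F a (N_proj nu) (tangent_map (fun nu : N => N_proj nu) nu v).
Definition gamma_N j nu v :=
  coframe_gamma t F j (N_proj nu) (tangent_map (fun nu : N => N_proj nu) nu v).
Definition maurer_cartan_N nu v :=
  maurer_cartan F (N_proj nu) (tangent_map (fun nu : N => N_proj nu) nu v).

Lemma maurer_cartan_NE nu v : maurer_cartan_N nu v = \sum_j gamma_N j nu v *: tnth t j.
Proof. exact/maurer_cartan_gamma/N_proj_dom. Qed.

Lemma canonical_eta_decomp nu v : canonical_eta nu v =
  \sum_a beta_N a nu v *: eta_mx a nu + maurer_cartan_N nu v.
Proof.
rewrite maurer_cartan_NE /canonical_eta.
exact: (normalized_form_decomp t (mm_dom nu) (nb_normalized (mm_proj nu))).
Qed.

Variable nu : N.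
Let s0 := center nu.
Let x0 := proj B (N_proj nu).
Let Phi : 'rV[R]__ -> 'rV[R]_n :=
  coord_at x0 \o ((fun nu : N => proj B (N_proj nu)) \o inv_at nu).
Let A := (fun nu : N => mat (gauge F (N_proj nu))) \o inv_at nu.
Let AV := (fun nu : N => mat (mlgV (gauge F (N_proj nu)))) \o inv_at nu.
Let H a := (fun nu : N => eta_mx a nu) \o inv_at nu.
Let T := local_coframe_mx F x0.
Let bt w x := 'D_w Phi x *m T (Phi x).

Let Phi_C2 : C2_near Phi s0.
Proof. exact: (C2_map_base nu).2. Qed.

Let A_C2 : C2_near A s0. Proof. exact: C2_gauge_N. Qed.

Let AV_diff : differentiable AV s0. Proof. exact/C2_near_diff/C2_gaugeV_N. Qed.

Let Phi_s0 : Phi s0 = center x0.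
Proof. by rewrite /Phi /= inv_center. Qed.

Let T_diff : differentiable T (Phi s0).
Proof. by rewrite Phi_s0; exact/local_coframe_mx_diff/N_proj_dom. Qed.

(** The left side involves the preferred chart of each nearby point, while [bt] uses one chart on N
    and one on M. They agree because beta^a is pulled back from M. *)
Lemma near_beta_N : \forall x \near s0, forall w a,
  beta_N a (inv_at nu x) (change_chart nu (inv_at nu x) x w) = bt w x 0 a.
Proof.
have sc := in_chart_center nu.
have cb : {for s0, continuous ((fun nu : N => proj B (N_proj nu)) \o inv_at nu)}.
  exact: C2_map_inv_cts (C2_map_base nu).1.
have n1 := near_in_chart sc.
have n2 : \forall x \near s0, chart_dom (chart_at x0) (proj B (N_proj (inv_at nu x))).
  by apply: (near_comp_dom cb); rewrite /= inv_center; exact: chart_at_dom.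
have n3 : \forall x \near s0, local_frame_mx F x0 (Phi x) *m T (Phi x) = 1%:M.
  have cP : {for s0, continuous Phi}.
    exact: differentiable_continuous (C2_near_diff Phi_C2).
  have := near_local_frameK (N_proj_dom nu); rewrite -/x0 -Phi_s0; exact: cP.
near=> x => w a.
have nx : in_chart nu x by near: x.
have xd : chart_dom (chart_at x0) (proj B (N_proj (inv_at nu x))) by near: x.
have ET : local_frame_mx F x0 (Phi x) *m T (Phi x) = 1%:M by near: x.
set q := inv_at nu x in xd *; set x1 := proj B (N_proj q) in xd *.
have dq : lf_dom F x1 by exact: N_proj_dom.
set bq := \row_a beta_N a q (change_chart nu q x w).
(* The frame matrix is invertible here, so it is enough to expand the velocity of the base point in
   the frame. *)
suff E1 : 'D_w Phi x = bq *m local_frame_mx F x0 (Phi x).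
  by rewrite /bt E1 -mulmxA ET mulmx1 mxE.
have cc : {for x, continuous ((fun nu : N => proj B (N_proj nu)) \o inv_at nu)}.
  apply: continuous_comp; first exact: chart_inv_continuous.
  exact: (C2_map_base q).1.
have dc : differentiable (coord_at x1 \o ((fun nu : N => proj B (N_proj nu)) \o inv_at nu)) x.
  exact: (local_diff (g := coord_at x1 \o (fun nu : N => proj B (N_proj nu))) nx
    (C2_near_diff (C2_map_base q).2)).
have dt : differentiable (coord_at x0 \o inv_at x1) (center x1).
  by apply: transition_diff => //; exact: chart_at_dom.
rewrite (chain_derive (g := coord_at x0) (q := x1) erefl cc dc dt).
rewrite (tangent_local w nx (C2_map_base q)).
rewrite (tangent_map_comp (change_chart nu q x w) (C2_map_N_proj q) (C2_map_proj B (N_proj q))).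
rewrite (proj_beta t dq) mulmx_sum_row.
have dl : linear (dfun (coord_at x0) x1) by exact: derive_linear.
pose dL0 := GRing.isLinear.Build _ _ _ _ (dfun (coord_at x0) x1) dl.
pose dL : {linear 'rV[R]_n -> 'rV[R]_n} := HB.pack (dfun (coord_at x0) x1) dL0.
rewrite -[LHS]/(dL _) linear_sum; apply: eq_bigr => b _.
rewrite linearZ mxE rowK; congr (_ *: _).
by rewrite /vfield_in_chart /Phi /= inv_coord.
Unshelve. all: by end_near. Qed.

Lemma near_canonical_eta : \forall x \near s0, forall w,
  canonical_eta (inv_at nu x) (change_chart nu (inv_at nu x) x w) =
  \sum_a bt w x 0 a *: H a x + AV x *m 'D_w A x.
Proof.
apply: filterS2 near_beta_N (near_in_chart (in_chart_center nu)) => x bE nx w.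
rewrite canonical_eta_decomp; congr (_ + _).
  by apply: eq_bigr => a _; rewrite bE.
rewrite /maurer_cartan_N /maurer_cartan; congr (_ *m _).
set q := inv_at nu x.
by rewrite /A (local_derive nx (C2_near_diff (C2_gauge_N _))) dfun_gauge_N.
Qed.

Let beta0 w a : bt w s0 0 a = beta_N a nu w.
Proof.
by rewrite -(nbhs_singleton near_beta_N) inv_center change_chart_id.
Qed.

Let theta0 w : AV s0 *m 'D_w A s0 = maurer_cartan_N nu w.
Proof.
rewrite /maurer_cartan_N /maurer_cartan {1}/AV /= inv_center; congr (_ *m _).
exact: dfun_gauge_N.
Qed.

Let bt_diff w : differentiable (bt w) s0.
Proof.
apply: differentiable_mulmx; first exact: C2_near_diff2.
apply: differentiable_comp T_diff; exact: C2_near_diff.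
Qed.

Let derive_bt u w : 'D_u (bt w) s0 = 'D_u (fun x => 'D_w Phi x) s0 *m T (Phi s0)
  + 'D_w Phi s0 *m 'D_('D_u Phi s0) T (center x0).
Proof.
have dP := C2_near_diff Phi_C2.
have E1 : 'D_u (fun y => T (Phi y)) s0 = 'D_('D_u Phi s0) T (Phi s0).
  exact: (derive_comp u dP T_diff).
rewrite derive_mulmx; [|exact: C2_near_diff2|exact: differentiable_comp].
by rewrite E1 Phi_s0.
Qed.

Definition structure_N a b c :=
  christoffel F omega a b c (N_proj nu) - christoffel F omega a c b (N_proj nu).

Let structure_NE a b c : structure_coef F x0 omega a b c = structure_N a b c.
Proof.
by rewrite /structure_N /christoffel !proj_frame_e //; exact: N_proj_dom.
Qed.

(** The second derivatives of [Phi] cancel by symmetry, which leaves d of the dual coframe of M on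
    the projected vectors: exterior differentiation commutes with pull-back. *)
Lemma d_beta_N u v a : 'D_u (bt v) s0 0 a - 'D_v (bt u) s0 0 a =
  - \sum_b \sum_c structure_N a b c * (beta_N b nu u * beta_N c nu v).
Proof.
have D (Z X Y : 'rV[R]_n) : (Z + X) 0 a - (Z + Y) 0 a = (X - Y) 0 a.
  by rewrite !mxE opprD addrACA subrr add0r.
rewrite !derive_bt (C2_derive_comm v u Phi_C2) D.
rewrite (d_local_coframe (N_proj_dom nu) nabla_lc omega_conn); congr (- _).
apply: eq_bigr => b _; apply: eq_bigr => c _; rewrite structure_NE.
by rewrite -!beta0 /bt Phi_s0.
Qed.

Definition d_eta_mx a v : 'M[R]_m :=
  \sum_i dfun (fun nu : N => eta_coef i a nu) nu v *: tnth t i.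

Let H_diff a : differentiable (H a) s0.
Proof.
rewrite (_ : H a = \sum_i (fun x => eta_coef i a (inv_at nu x) *: tnth t i)).
  apply: differentiable_sum => i; apply: differentiableZl.
  exact: eta_coef_diff.
by apply/funext => x; rewrite fct_sumE.
Qed.

Let derive_H a v : 'D_v (H a) s0 = d_eta_mx a v.
Proof.
rewrite (_ : H a = \sum_i (fun x => eta_coef i a (inv_at nu x) *: tnth t i)); last first.
  by apply/funext => x; rewrite fct_sumE.
have dZ i : differentiable (fun x => eta_coef i a (inv_at nu x) *: tnth t i) s0.
  by apply: differentiableZl; exact: eta_coef_diff.
rewrite derive_sum; last by move=> i; exact: diff_derivable.
apply: eq_bigr => i _.
rewrite derive_scale; [|exact: eta_coef_diff|exact: differentiable_cst].
by rewrite (derive_cst (tnth t i)) scaler0 addr0.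
Qed.

Let loc w := \sum_a (fun x => bt w x 0 a *: H a x) + (fun x => AV x *m 'D_w A x).

(** The product of two values of A^-1 dA comes from the derivative of A^-1, which is - A^-1 dA
    A^-1. *)
Let derive_loc u w : 'D_u (loc w) s0 =
  \sum_a ('D_u (bt w) s0 0 a *: eta_mx a nu + beta_N a nu w *: d_eta_mx a u)
  + (- (maurer_cartan_N nu u *m maurer_cartan_N nu w) + AV s0 *m 'D_u (fun x => 'D_w A x) s0).
Proof.
have db a : differentiable (fun x => bt w x 0 a) s0 by exact: differentiable_entry.
have ds a : differentiable (fun x => bt w x 0 a *: H a x) s0.
  exact: differentiable_scale.
have dA := C2_near_diff2 w A_C2.
rewrite /loc deriveD; first last.
- by apply: diff_derivable; exact: differentiable_mulmx.
- by apply: diff_derivable; exact: differentiable_sum.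
congr (_ + _).
  rewrite derive_sum; last by move=> a; exact: diff_derivable.
  apply: eq_bigr => a _; rewrite (derive_scale u (db a) (H_diff a)) derive_H beta0.
  by rewrite -(derive_entry u 0 a (bt_diff w)) /H /= inv_center.
rewrite derive_mulmx //; congr (_ + _).
have inv1 : \forall x \near s0, AV x *m A x = 1%:M.
  by near=> x; rewrite /AV /A /= matV.
rewrite (derive_left_inverse u (C2_near_diff A_C2) AV_diff inv1).
by rewrite mulNmx -[_ *m _ *m AV s0 *m _]mulmxA !theta0.
Unshelve. all: by end_near. Qed.

Lemma dform_canonical_eta u v :
  dform (fun nu : N => canonical_eta nu) nu u v =
  \sum_a ((- \sum_b \sum_c structure_N a b c * (beta_N b nu u * beta_N c nu v)) *: eta_mx a nu
     + (beta_N a nu v *: d_eta_mx a u - beta_N a nu u *: d_eta_mx a v))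
  - (maurer_cartan_N nu u *m maurer_cartan_N nu v - maurer_cartan_N nu v *m maurer_cartan_N nu u).
Proof.
have nl w : \forall x \near s0, canonical_eta (inv_at nu x)
    (change_chart nu (inv_at nu x) x w) = loc w x.
  apply: filterS near_canonical_eta => x ->.
  by rewrite /loc -[RHS]/((\sum_a (fun x => bt w x 0 a *: H a x)) x + _) fct_sumE.
have sub_eq (X X' Y Y' : 'M[R]_m) : X = X' -> Y = Y' -> X - Y = X' - Y'.
  by move=> -> ->.
apply: etrans (sub_eq _ _ _ _ (near_eq_derive u (nl v)) (near_eq_derive v (nl u))) _.
apply: etrans (sub_eq _ _ _ _ (derive_loc u v) (derive_loc v u)) _.
have split_eq (S S' W W' L L' : 'M[R]_m) : S - S' = L -> W - W' = L' ->
    S + W - (S' + W') = L + L'.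
  by move=> <- <-; rewrite opprD addrACA.
(* X and Y are the products of the values of A^-1 dA on u and v in both orders; Z and Z' are A^-1
   times the mixed second derivatives of A. *)
have cancel_eq (X Y Z Z' : 'M[R]_m) : Z = Z' -> - X + Z - (- Y + Z') = - (X - Y).
  by move=> ->; rewrite opprD addrACA subrr addr0 opprB opprK addrC.
apply: split_eq; last first.
  exact: cancel_eq (congr1 (mulmx (AV s0)) (C2_derive_comm v u A_C2)).
rewrite -sumrB; apply: eq_bigr => a _.
by rewrite opprD addrACA -scalerBl d_beta_N.
Qed.

End StructureEquations.

(** * The curvature and the momenta *)

Section ExtEvaluation.
Variables (R : comNzRingType) (V : Type).

Lemma ext_sumE (I : finType) (f : I -> ext R V) s : (\sum_i f i) s = \sum_i f i s.
Proof. by rewrite (big_morph (fun a : ext R V => a s) (id1 := 0) (op1 := +%R)). Qed.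

Lemma extDE (a b : ext R V) s : (a + b) s = a s + b s. Proof. by []. Qed.
Lemma extNE (a : ext R V) s : (- a) s = - a s. Proof. by []. Qed.

End ExtEvaluation.

Section PcExpression.
Variables (R : realType) (n r m : nat) (M : manifold R n) (g : metric M).
Variables (G : matrix_lie_group R r m) (t : lie_basis G).
Variables (P : manifold R (n + r)) (B : principal_bundle M G P).
Variable F : local_frame g B.
Variable z : P.
Variables (V : Type) (f : V -> 'rV[R]_(n + r)) (deta : 'I_r -> 'I_n -> V -> R) (e : R).
Variables (p : 'I_r -> 'I_n -> 'I_n -> R) (q : 'I_r -> 'I_n -> 'I_r -> R).

Let beta := vol (fun a => coframe_beta t F a z).
Let gamma := vol (fun j => coframe_gamma t F j z).

Lemma pc_expressionE : pc_expression t F z f deta e p q =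
  e *: (pull f beta * pull f gamma)
  + \sum_i \sum_a \sum_b p i a b *: (ext1 (deta i a) *
      (pull f (iext (frame_e F b z) beta) * pull f gamma))
  + (-1) ^+ n *: \sum_i \sum_a \sum_j q i a j *: (ext1 (deta i a) *
      (pull f beta * pull f (iext (frame_rho t B j z) gamma))).
Proof.
apply/funext => s; rewrite !extDE !extZE !ext_sumE /pc_expression.
congr (_ + _ + _ * _); apply: eq_bigr => i _; rewrite ext_sumE; apply: eq_bigr => a _;
  by rewrite ext_sumE.
Qed.

End PcExpression.

Lemma pullback_pc_expression (R : realType) (n r m : nat) (M : manifold R n) (g : metric M)
  (G : matrix_lie_group R r m) (t : lie_basis G)
  (P : manifold R (n + r)) (B : principal_bundle M G P) (F : local_frame g B) (z : P)
  (V W : Type) (h : W -> V) (f : V -> 'rV[R]_(n + r)) deta e p q :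
  pullback h (pc_expression t F z f deta e p q) =
  pc_expression t F z (f \o h) (fun i a => deta i a \o h) e p q.
Proof.
have pull_sum (I : finType) (k : I -> ext R V) : pull h (\sum_i k i) = \sum_i pull h (k i).
  by apply/funext => s; rewrite ext_sumE -[LHS]/((\sum_i k i) (map h s)) ext_sumE.
have pull_comp (k : ext R 'rV[R]_(n + r)) : pull h (pull f k) = pull (f \o h) k.
  by apply/funext => s; rewrite /pull /pullback map_comp.
have pullD (a b : ext R V) : pull h (a + b) = pull h a + pull h b by [].
rewrite !pc_expressionE -[LHS]/(pull h _) !pullD !pullZ !pull_sum pullM !pull_comp.
congr (_ + _ + _ *: _); apply: eq_bigr => i _; rewrite pull_sum; apply: eq_bigr => a _;
  rewrite pull_sum; apply: eq_bigr => b _; by rewrite pullZ !pullM pull_ext1 !pull_comp.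
Qed.

Section Curvature.
Variables (R : realType) (n r m : nat) (M : manifold R n) (g : metric M).
Variables (nabla : vfield M -> M -> 'rV[R]_n -> 'rV[R]_n).
Hypothesis nabla_lc : levi_civita g nabla.
Variables (G : matrix_lie_group R r m) (t : lie_basis G).
Variables (P : manifold R (n + r)) (B : principal_bundle M G P).
Variable F : local_frame g B.
Variable omega : 'I_n -> 'I_n -> M -> 'rV[R]_n -> R.
Hypothesis omega_conn : connection_forms F nabla omega.
Variables (E : normalized_bundle t F) (N : multimomentum_manifold E) (nu : N).

Local Notation bN a := (beta_N a nu).
Local Notation cN j := (gamma_N j nu).
Local Notation dN i a := (dfun (fun nu : N => eta_coef i a nu) nu).

(** The coefficient F^i_ab. The subtracted sum is the contribution of d beta^c. *)
Definition curv_base i a b : R :=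
  coord t i (commutator (eta_mx a nu) (eta_mx b nu))
  - \sum_c structure_N omega nu c a b * eta_coef i c nu.

Definition curv_mixed i a j : R := coord t i (commutator (eta_mx a nu) (tnth t j)).

Lemma commutator_sum (I J : finType) (k : I -> R) (l : J -> R)
    (X : I -> 'M[R]_m) (Y : J -> 'M[R]_m) :
  commutator (\sum_i k i *: X i) (\sum_j l j *: Y j) =
  \sum_i \sum_j (k i * l j) *: commutator (X i) (Y j).
Proof.
rewrite /commutator mulmx_suml.
under eq_bigr => i _ do rewrite mulmx_sumr.
rewrite mulmx_suml exchange_big [X in _ - X](eq_bigr (fun j => \sum_i (k i * l j) *: (Y j *m X i))).
  rewrite -sumrB exchange_big /=; apply: eq_bigr => i _; rewrite -sumrB.
  apply: eq_bigr => j _; rewrite -scalemxAl -scalemxAr scalerA scalerBr //.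
move=> j _; rewrite mulmx_sumr; apply: eq_bigr => i _.
by rewrite -scalemxAl -scalemxAr scalerA mulrC.
Qed.

Lemma commutatorDl (X Y Z : 'M[R]_m) : commutator (X + Y) Z = commutator X Z + commutator Y Z.
Proof. by rewrite /commutator mulmxDl mulmxDr opprD addrACA. Qed.

Lemma commutatorDr (X Y Z : 'M[R]_m) : commutator X (Y + Z) = commutator X Y + commutator X Z.
Proof. by rewrite /commutator mulmxDl mulmxDr opprD addrACA. Qed.

Lemma commutatorC (X Y : 'M[R]_m) : commutator X Y = - commutator Y X.
Proof. by rewrite /commutator opprB. Qed.

(** Applied to the values of eta on u and v. The two mixed parts merge by antisymmetry; the last
    summand is the gamma /\ gamma part. *)
Lemma commutator_decomp (bu bv : 'I_n -> R) (cu cv : 'I_r -> R)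
    (H : 'I_n -> 'M[R]_m) (T : 'I_r -> 'M[R]_m) :
  commutator (\sum_a bu a *: H a + \sum_j cu j *: T j)
    (\sum_a bv a *: H a + \sum_j cv j *: T j) =
  \sum_a \sum_b (bu a * bv b) *: commutator (H a) (H b)
  + \sum_a \sum_j (bu a * cv j - bv a * cu j) *: commutator (H a) (T j)
  + commutator (\sum_j cu j *: T j) (\sum_j cv j *: T j).
Proof.
rewrite commutatorDl !commutatorDr addrA; congr (_ + _).
rewrite -addrA [commutator (\sum_j cu j *: T j) _]commutatorC !commutator_sum.
congr (_ + _); rewrite -sumrB; apply: eq_bigr => a _.
by rewrite -sumrB; apply: eq_bigr => j _; rewrite scalerBl.
Qed.

(** In d eta the index c of beta^c is summed outermost, in [curv_base] innermost. *)
Lemma sum_torsion (bu bv e : 'I_n -> R) (K : 'I_n -> 'I_n -> R) (S : 'I_n -> 'I_n -> 'I_n -> R) :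
  \sum_a \sum_b (K a b - \sum_c S c a b * e c) * (bu a * bv b) =
  \sum_a \sum_b (bu a * bv b) * K a b
  - \sum_c (\sum_a \sum_b S c a b * (bu a * bv b)) * e c.
Proof.
under [X in _ - X]eq_bigr => c _ do (rewrite mulr_suml;
  under eq_bigr => a _ do rewrite mulr_suml).
rewrite [X in _ - X]exchange_big -sumrB /=; apply: eq_bigr => a _.
rewrite [X in _ - X]exchange_big -sumrB /=; apply: eq_bigr => b _.
rewrite mulrBl mulr_suml; congr (_ - _); first exact: mulrC.
by apply: eq_bigr => c _; rewrite mulrAC.
Qed.

Lemma curvature_two_form i : curvature i nu = two_form (fun u v =>
  \sum_a (dN i a u * bN a v - dN i a v * bN a u)
  + \sum_a \sum_b curv_base i a b * (bN a u * bN b v)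
  + \sum_a \sum_j curv_mixed i a j * (bN a u * cN j v - bN a v * cN j u)).
Proof.
apply/funext => s; rewrite /curvature wedge_one_form.
case: s => [|u [|v [|w s]]] /=; rewrite ?addr0 ?linear0 //.
have eta_mx_coord a : coord t i (eta_mx a nu) = eta_coef i a nu.
  exact: coord_sum_basis.
have d_eta_coord a w : coord t i (d_eta_mx nu a w) = dN i a w.
  exact: coord_sum_basis.
(* d is the commutator of the two values of A^-1 dA, which d eta subtracts and eta /\ eta adds. *)
have split_eq (X S d : 'M[R]_m) : X - d + (S + d) = X + S.
  by rewrite addrACA addNr addr0.
rewrite (dform_canonical_eta nabla_lc omega_conn) -[X in _ + X]/(commutator _ _).
rewrite !canonical_eta_decomp !maurer_cartan_NE commutator_decomp split_eq addrA.
have LD (X Y : 'M[R]_m) : coord t i (X + Y) = coord t i X + coord t i Y.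
  exact: linearD.
have LB (X Y : 'M[R]_m) : coord t i (X - Y) = coord t i X - coord t i Y.
  exact: linearB.
have LZ (c : R) (X : 'M[R]_m) : coord t i (c *: X) = c * coord t i X.
  exact: linearZ.
have LS k (X : 'I_k -> 'M[R]_m) : coord t i (\sum_j X j) = \sum_j coord t i (X j).
  exact: linear_sum.
rewrite [LHS]LD [X in X + _]LD !LS; congr (_ + _); last first.
  by apply: eq_bigr => a _; rewrite LS; apply: eq_bigr => j _; rewrite LZ mulrC.
have -> : \sum_a \sum_b curv_base i a b * (bN a u * bN b v) =
   \sum_a \sum_b (bN a u * bN b v) * coord t i (commutator (eta_mx a nu) (eta_mx b nu))
   - \sum_c (\sum_a \sum_b structure_N omega nu c a b * (bN a u * bN b v)) * eta_coef i c nu.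
  exact: (sum_torsion (fun a => bN a u) (fun b => bN b v)).
set C := \sum_a \sum_b _ * coord t i _; set S := \sum_c _ * eta_coef i c nu.
set D := \sum_a (dN i a u * _ - _).
have -> : \sum_a coord t i
    ((- \sum_b \sum_c structure_N omega nu a b c * (bN b u * bN c v)) *: eta_mx a nu
    + (bN a v *: d_eta_mx nu a u - bN a u *: d_eta_mx nu a v)) = D - S.
  rewrite -sumrB; apply: eq_bigr => a _.
  have L3 c d d' (X Y Z : 'M[R]_m) x y z :
      coord t i X = x -> coord t i Y = y -> coord t i Z = z ->
      coord t i (- c *: X + (d *: Y - d' *: Z)) = y * d - z * d' - c * x.
    by move=> <- <- <-; rewrite LD LB !LZ addrC mulNr [d * _]mulrC [d' * _]mulrC.
  exact: L3 (eta_mx_coord a) (d_eta_coord a u) (d_eta_coord a v).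
have EC : \sum_a coord t i (\sum_b (bN a u * bN b v) *: commutator (eta_mx a nu) (eta_mx b nu)) = C.
  by apply: eq_bigr => a _; rewrite LS; apply: eq_bigr => b _; rewrite LZ.
by rewrite EC addrAC -addrA.
Qed.

End Curvature.

(** A product of 1-forms is already antisymmetrized, so an antisymmetric K is counted twice: hence
    the factor 1/2. *)
Lemma two_form_ext (R : numFieldType) (V : Type) (n r : nat) (X b : 'I_n -> V -> R)
    (c : 'I_r -> V -> R) (K : 'I_n -> 'I_n -> R) (L : 'I_n -> 'I_r -> R) :
  (forall i j, K i j = - K j i) ->
  two_form (fun u v => \sum_a (X a u * b a v - X a v * b a u)
    + \sum_a \sum_d K a d * (b a u * b d v)
    + \sum_a \sum_j L a j * (b a u * c j v - b a v * c j u)) =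
  \sum_a ext1 (X a) * ext1 (b a)
  + 2^-1 *: \sum_a \sum_d K a d *: (ext1 (b a) * ext1 (b d))
  + \sum_a \sum_j L a j *: (ext1 (b a) * ext1 (c j)) :> ext R V.
Proof.
move=> Kasym; apply/funext => s; rewrite !extDE !extZE !ext_sumE.
under [X in _ = X + _ + _]eq_bigr => a _ do rewrite ext1M.
under [X in _ = _ + 2^-1 * X + _]eq_bigr => a _ do (rewrite ext_sumE;
  under eq_bigr => d _ do rewrite extZE ext1M).
under [X in _ = _ + X]eq_bigr => a _ do (rewrite ext_sumE;
  under eq_bigr => d _ do rewrite extZE ext1M).
have zero2 (I J : finType) (M : I -> J -> R) : \sum_i \sum_j M i j * 0 = 0.
  by rewrite big1 // => i _; rewrite big1 // => j _; rewrite mulr0.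
case: s => [|u [|v [|w s]]] /=; rewrite ?zero2 ?big1_eq ?mulr0 ?addr0 //.
congr (_ + _ + _).
have swap : \sum_a \sum_d K a d * (b a v * b d u) = - \sum_a \sum_d K a d * (b a u * b d v).
  rewrite exchange_big -sumrN; apply: eq_bigr => d _; rewrite -sumrN.
  by apply: eq_bigr => a _; rewrite Kasym mulNr [b a v * _]mulrC.
under [X in _ = _ * X]eq_bigr => a _ do (under eq_bigr => d _ do rewrite mulrBr; rewrite sumrB).
by rewrite sumrB swap opprK -mulr2n -[X in _ = _ * X]mulr_natl mulKf // pnatr_eq0.
Qed.

(** * Assembly of the identity at a point of N *)

Section Main.
Variables (R : realType) (n r m : nat) (M : manifold R n) (g : metric M).
Variables (nabla : vfield M -> M -> 'rV[R]_n -> 'rV[R]_n).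
Hypothesis nabla_lc : levi_civita g nabla.
Variables (G : matrix_lie_group R r m) (t : lie_basis G).
Variables (P : manifold R (n + r)) (B : principal_bundle M G P).
Variable F : local_frame g B.
Variable omega : 'I_n -> 'I_n -> M -> 'rV[R]_n -> R.
Hypothesis omega_conn : connection_forms F nabla omega.
Variables (E : normalized_bundle t F) (N : multimomentum_manifold E) (nu : N).

Local Notation z := (N_proj nu).
Local Notation dproj := (tangent_map (fun x : N => N_proj x) nu).
Local Notation dN i a := (dfun (fun x : N => eta_coef i a x) nu).
Local Notation dimN := (n + r + r * n + (1 + r * 'C(n, 2) + r * n * r))%N.

Let b a := coframe_beta t F a z.
Let c j := coframe_gamma t F j z.

(** The form at nu has this expansion on E. Pull-back along N -> E respects products, and the chain
    rule turns the composites into differentials on N. *)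
Lemma poincare_cartan_pc : poincare_cartan nu =
  pc_expression t F z dproj (fun i a => dN i a)
    (mm_e nu) (fun i a b => mm_p i a b nu) (fun i a j => mm_q i a j nu).
Proof.
rewrite /poincare_cartan mm_components pullback_pc_expression.
have Ef : tangent_map (@nb_proj _ _ _ _ _ _ _ _ _ _ _ E) (mm_proj nu) \o
    tangent_map (fun x : N => mm_proj x) nu = dproj.
  apply/funext => v; apply/esym.
  exact: (tangent_map_comp v (C2_map_mm nu) (smooth_map_C2 (nb_proj_smooth (mm_proj nu)))).
have Ed : (fun i a => dfun (@nb_coef _ _ _ _ _ _ _ _ _ _ _ E i a) (mm_proj nu) \o
    tangent_map (fun x : N => mm_proj x) nu) = (fun i a => dN i a).
  apply/funext => i; apply/funext => a; apply/funext => v.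
  exact/esym/dfun_eta_coef.
exact: (f_equal2 (fun f d => pc_expression t F z f d (mm_e nu) _ _) Ef Ed).
Qed.

Lemma curv_base_asym i a d : curv_base omega nu i a d = - curv_base omega nu i d a.
Proof.
have KK : coord t i (commutator (eta_mx a nu) (eta_mx d nu)) =
    - coord t i (commutator (eta_mx d nu) (eta_mx a nu)).
  exact: etrans (congr1 (coord t i) (commutatorC _ _)) (linearN _ _).
have SS : \sum_k structure_N omega nu k a d * eta_coef i k nu =
    - \sum_k structure_N omega nu k d a * eta_coef i k nu.
  by rewrite -sumrN; apply: eq_bigr => k _; rewrite /structure_N -mulNr opprB.
have sub_opp (X Y x y : R) : X = - Y -> x = - y -> X - x = - (Y - y).
  by move=> -> ->; rewrite opprK opprB addrC.
exact: sub_opp KK SS.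
Qed.

Lemma curvature_ext i : curvature i nu =
  \sum_a ext1 (dN i a) * ext1 (b a \o dproj)
  + 2^-1 *: \sum_a \sum_d curv_base omega nu i a d *: (ext1 (b a \o dproj) * ext1 (b d \o dproj))
  + \sum_a \sum_j curv_mixed nu i a j *: (ext1 (b a \o dproj) * ext1 (c j \o dproj))
  :> ext R 'rV[R]_dimN.
Proof.
rewrite (curvature_two_form nabla_lc omega_conn).
rewrite -(two_form_ext (fun a => dN i a) (fun a => b a \o dproj) (fun j => c j \o dproj)) //.
exact: curv_base_asym.
Qed.

Lemma momentum_form_ext i : momentum_form i nu =
  momentum dproj b c (fun a => frame_e F a z) (fun j => frame_rho t B j z)
    (fun a d => mm_p i a d nu) (fun a j => mm_q i a j nu).
Proof.
apply/funext => s; rewrite /momentum extDE extNE !extZE !ext_sumE.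
congr (- (_ * _) + _ * _); apply: eq_bigr => a _; rewrite ext_sumE;
  apply: eq_bigr => d _; exact: extZE.
Qed.

Lemma mm_p_asym i a d : mm_p i a d nu + mm_p i d a nu = 0.
Proof. by have [_ _ H] := mm_fibre nu; exact: H (mm_components nu) i a d. Qed.

(** Regroups epsilon so that the correction to e is, for each i, the coefficient that
    [momentum_curvature] subtracts. *)
Lemma epsilonE : epsilon omega nu = mm_e nu + \sum_i
  (2^-1 * (\sum_a \sum_d mm_p i a d nu * curv_base omega nu i a d)
   + \sum_a \sum_j mm_q i a j nu * curv_mixed nu i a j).
Proof.
rewrite big_split /= -[in RHS]mulr_sumr.
have regroup (e x y w q : R) : x = y - w -> e - 2^-1 * w + 2^-1 * y + q = e + (2^-1 * x + q).
  by move=> ->; ring.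
apply: regroup; rewrite -sumrB; apply: eq_bigr => i _.
rewrite -sumrB; apply: eq_bigr => a _; rewrite -sumrB; apply: eq_bigr => d _.
rewrite /curv_base mulrBr mulr_sumr; congr (_ - _).
by apply: eq_bigr => k _; rewrite /structure_N mulrAC -mulrA.
Qed.

Lemma poincare_cartan_momentum s : poincare_cartan nu s =
  epsilon omega nu * wedge (from_P (vol_beta t F) nu) (from_P (vol_gamma t F) nu) s
  + \sum_i wedge (momentum_form i nu) (curvature i nu) s.
Proof.
pose bg : ext R 'rV[R]_dimN := pull dproj (vol b) * pull dproj (vol c).
suff H : poincare_cartan nu =
    epsilon omega nu *: bg + \sum_i (momentum_form i nu : ext _ _) * curvature i nu.
  by rewrite H extDE extZE ext_sumE.
rewrite poincare_cartan_pc pc_expressionE.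
have be := coframe_beta_e t (N_proj_dom nu).
have crho := coframe_gamma_rho t (N_proj_dom nu).
under [X in _ = _ + X]eq_bigr => i _ do rewrite momentum_form_ext curvature_ext
  (momentum_curvature dproj be crho _ (mm_p_asym i)).
rewrite sumrB big_split /= -scaler_sumr -scaler_suml.
(* x is beta /\ gamma and k the total correction: what epsilon adds to e, the products of p_i with
   the curvature take away. *)
have regroup (x S S' : ext R 'rV[R]_dimN) (e e' k : R) : e' = e + k ->
    e *: x + S + S' = e' *: x + (S + S' - k *: x).
  by move=> ->; rewrite scalerDl [_ - _]addrC addrA addrK addrA.
exact: regroup epsilonE.
Qed.

End Main.

Theorem proposition2p1 (R : realType) (n r m : nat)
  (M : manifold R n) (g : metric M)
  (nabla : vfield M -> M -> 'rV[R]_n -> 'rV[R]_n)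
  (nabla_lc : levi_civita g nabla)
  (G : matrix_lie_group R r m) (t : lie_basis G)
  (P : manifold R (n + r)) (B : principal_bundle M G P)
  (F : local_frame g B)
  (omega : 'I_n -> 'I_n -> M -> 'rV[R]_n -> R)
  (omega_conn : connection_forms F nabla omega)
  (E : normalized_bundle t F) (N : multimomentum_manifold E) (nu : N) :
  let z := N_proj nu in
  let dproj := tangent_map (fun x : N => N_proj x) nu in
  [/\ poincare_cartan nu =
        pc_expression t F z dproj
          (fun i a => dfun (fun x : N => eta_coef i a x) nu)
          (mm_e nu) (fun i a b => mm_p i a b nu) (fun i a j => mm_q i a j nu),
      forall v, canonical_eta nu v =
        \sum_a coframe_beta t F a z (dproj v) *: eta_mx a nu
        + \sum_i coframe_gamma t F i z (dproj v) *: tnth t i &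
      forall s, poincare_cartan nu s =
        epsilon omega nu *
          wedge (from_P (vol_beta t F) nu) (from_P (vol_gamma t F) nu) s
        + \sum_i wedge (momentum_form i nu) (curvature i nu) s].
Proof.
split.
- exact: poincare_cartan_pc.
- by move=> v; rewrite canonical_eta_decomp maurer_cartan_NE.
- by move=> s; exact: (poincare_cartan_momentum nabla_lc omega_conn).
Qed.
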